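(* Under a fixed user distribution $F(\cdot)$, denote the ISP's optimal range of service qualities under the maximum capacity $C_{M1}$ and $C_{M2}$ as $\mathcal{Q}_1$ and $\mathcal{Q}_2$, respectively. If $C_{M1}<C_{M2}$, then $\mathcal{Q}_1\subset\mathcal{Q}_2$.
   Context: Users have types $\theta\in[0,1]$ distributed with density $f$ (continuously differentiable and strictly positive on $[0,1]$) and cumulative distribution function $F$. The function $v:[0,1]\to\mathbb{R}_+$ is continuously differentiable and strictly decreasing with $v(0)=1$, $v(1)=0$. The function $w:[0,1]\to\mathbb{R}_+$ is continuously differentiable and decreasing with $w(1)=0$ (the case $w(0)=+\infty$ is also considered). A strategy (service differentiation) of the Internet Service Provider (ISP) is a pair $(\mathcal{Q},p)$, where $\mathcal{Q}\subseteq[0,1]$ is the set of offered service qualities (congestion levels) and $p:\mathcal{Q}\to\mathbb{R}_+$ gives their prices; users may always choose the dummy class $q=1$ with $p(1)=0$ (opting out). The user choice function satisfies $q(\theta)\in\arg\max_{q\in\mathcal{Q}}\theta v(q)-p(q)$. In the fixed capacity scenario with maximum capacity $C_M$, the ISP chooses its strategy to maximize $\int_0^1p(q(\theta))f(\theta)\,\mathrm{d}\theta$ subject to $\int_0^1 w(q(\theta))f(\theta)\,\mathrm{d}\theta\le C_M$. Assumptions: the virtual valuation $G(\theta)=\theta-\frac{1-F(\theta)}{f(\theta)}$ has a unique zero $\theta_0$ on $(0,1)$ and is strictly increasing on $(\theta_0,1)$, with $G^{-1}$ its inverse over $(\theta_0,1)$; the virtual capacity $h(q)=w'(q)/v'(q)$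 is decreasing in $q$ over $(0,1)$, and $h^{-1}$, defined over $[h(1),+\infty)$, is the inverse of $h$ over $[h(1),h(0)]$ and zero over $(h(0),+\infty)$. Put $\bar C=[1-F(\theta_0)]w(0)$. If $C_M<\bar C$, the optimal user choice function $q^*$ (the user choice function under the optimal strategy), the marginal user $\hat\theta$ and the shadow price $\mu$ are determined by: $q^*(\theta)=1$ for $\theta\in[0,\hat\theta)$ and $q^*(\theta)=h^{-1}(G(\theta)/\mu)$ for $\theta\in[\hat\theta,1]$; $\hat\theta=G^{-1}(\mu h(1))$; $\int_0^1w(q^*(\theta))f(\theta)\,\mathrm{d}\theta=C_M$. Otherwise the optimal strategy is a single-class service with $\mathcal{Q}=\{0\}$ and price $\theta_0$. The optimal range of service qualities is the set of service qualities offered under the optimal strategy, described as the interval $\mathcal{Q}^*=[q^*(1),q^*(\hat\theta)]$.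
   Formalization: The two maximum capacities are assumed to be both below C̄ or both at least C̄, since for C_M1 < C̄ ≤ C_M2 the range Q_2={0} does not contain Q_1, which contains 1; ⊂ is non-strict, and q* at types 1 and θ̂ is fixed by one-sided continuity. *)

(* Defs.v *)
(* MathComp-Analysis, over an arbitrary [R : realType]. *)
From mathcomp Require Export all_boot all_order all_algebra.
From mathcomp Require Export all_classical all_reals all_analysis.
Export Order.TTheory GRing.Theory Num.Theory.
Export numFieldNormedType.Exports.

Set Implicit Arguments.
Unset Strict Implicit.
Unset Printing Implicit Defensive.

Local Open Scope classical_set_scope.
Local Open Scope ring_scope.

(* Functions on [0, 1] are total functions on R of which only the values on
   [0, 1] matter. *)

(* Class C^1 on the closed interval [a, b]: the derivative on ]a, b[ extends
   continuously to the endpoints. *)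
Definition C1_on (R : realType) (a b : R) (g : R -> R) : Prop :=
  [/\ {within `[a, b], continuous g},
      forall x, a < x < b -> derivable g x 1
    & exists2 g' : R -> R, {within `[a, b], continuous g'} &
        forall x, a < x < b -> derive1 g x = g' x].

(* w takes values in \bar R because w 0 = +oo is allowed; in that case w is C^1
   on ]0, 1] and continuous at 0 as an extended-real function. *)
Definition C1_capacity (R : realType) (w : R -> \bar R) : Prop :=
  (forall q : R, 0 < q <= 1 -> w q \is a fin_num) /\
  ((w 0 \is a fin_num /\ C1_on 0 1 (fine \o w)) \/
   [/\ w 0 = +oo%E, w q @[q --> 0^'+] --> +oo%E
     & forall a : R, 0 < a < 1 -> C1_on a 1 (fine \o w)]).

Definition cdf_of (R : realType) (f : R -> R) (t : R) : R :=
  Rintegral lebesgue_measure `[0, t] f.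

Definition virtual_valuation (R : realType) (f : R -> R) (t : R) : R :=
  t - (1 - cdf_of f t) / f t.

Definition virtual_capacity (R : realType) (v : R -> R) (w : R -> \bar R)
    (q : R) : R :=
  derive1 (fine \o w) q / derive1 v q.

Definition strategy (R : realType) (Q : set R) (p : R -> R) : Prop :=
  [/\ Q `<=` `[0, 1], forall x, Q x -> 0 <= p x & p 1 = 0].

(* The dummy class 1 is always available, whether or not it belongs to Q. *)
Definition user_choice (R : realType) (v : R -> R) (Q : set R) (p : R -> R)
    (q : R -> R) : Prop :=
  forall t, 0 <= t <= 1 ->
    (Q `|` [set 1]) (q t) /\
    forall x, (Q `|` [set 1]) x -> t * v x - p x <= t * v (q t) - p (q t).

Definition revenue (R : realType) (f p q : R -> R) : \bar R :=
  (\int[lebesgue_measure]_(t in `[0%R, 1%R]) (p (q t) * f t)%:E)%E.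

Definition capacity_used (R : realType) (f : R -> R) (w : R -> \bar R)
    (q : R -> R) : \bar R :=
  (\int[lebesgue_measure]_(t in `[0%R, 1%R]) (w (q t) * (f t)%:E))%E.

Definition feasible (R : realType) (f v : R -> R) (w : R -> \bar R) (C : R)
    (Q : set R) (p q : R -> R) : Prop :=
  [/\ strategy Q p, user_choice v Q p q & (capacity_used f w q <= C%:E)%E].

Definition optimal_strategy (R : realType) (f v : R -> R) (w : R -> \bar R)
    (C : R) (Q : set R) (p q : R -> R) : Prop :=
  feasible f v w C Q p q /\
  forall Q' p' q', feasible f v w C Q' p' q' ->
    (revenue f p' q' <= revenue f p q)%E.

(* Types below the marginal user opt out. *)
Definition marginal_user (R : realType) (q : R -> R) : R :=
  sup [set t | 0 <= t <= 1 /\ q t = 1].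

(* At the top type 1 and at the marginal type, user choice and optimality may
   leave a tie between several classes (for instance, the highest type may be
   indifferent between its class and an otherwise unused, better and dearer
   one). These two types form a null set; their choices are fixed by
   one-sided continuity from the served types, so an indifferent marginal user
   joins if everyone above does. *)
Definition continuous_at_end_types (R : realType) (q : R -> R) : Prop :=
  q t @[t --> 1^'-] --> q 1 /\
  (marginal_user q < 1 ->
   q t @[t --> (marginal_user q)^'+] --> q (marginal_user q)).

(* Qualities that no user chooses can be added to an optimal Q at prohibitive
   prices, so the range is read off the user choice function q: it is the
   interval from the best quality q 1 to the quality of the marginal user. *)
Definition optimal_range (R : realType) (f v : R -> R) (w : R -> \bar R)
    (C : R) (Qopt : set R) : Prop :=
  exists Q p q,
    [/\ optimal_strategy f v w C Q p q, continuous_at_end_types q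
      & Qopt = [set` `[q 1, q (marginal_user q)]]].

(* Capacity needed to give the best quality to all types above t0. From this
   capacity on, the optimum is the single class {0}; the range for such a
   capacity does not contain the range for a smaller, scarce capacity. *)
Definition saturating_capacity (R : realType) (f : R -> R) (w : R -> \bar R)
    (t0 : R) : \bar R :=
  ((1 - cdf_of f t0)%:E * w 0%R)%E.

(* Main.v *)
(* Write [x = v o q] for the value of the quality chosen by each type. By the
   envelope theorem a strategy is the same thing as a nondecreasing [x], with
   revenue the integral of [x t * g t], [g] being the virtual valuation times
   the density, and capacity the integral of [phi (x t) * f t] for
   [phi = w o v^-1]. As [phi' = w' / v'], [phi] is strictly convex, so every
   optimum for a positive capacity has a Lagrange multiplier, which decreases
   with the capacity. Capping or raising an optimal [x] on an interval of types
   keeps it nondecreasing and cannot increase the Lagrangian. Such truncations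
   near the type 1 show that [x 1] increases with the capacity; around the
   marginal type they show that, while capacity is scarce, [x] leaves 0
   continuously, i.e., the worst quality served is 1. When capacity is not
   scarce, comparison with the single class 0 sold to the types above [t0] shows
   that this class is the optimum. *)
From mathcomp Require Import ring lra measurable_realfun.
Require Import Defs.

Set Implicit Arguments.
Unset Strict Implicit.
Unset Printing Implicit Defensive.

Local Open Scope classical_set_scope.
Local Open Scope ring_scope.

(** * Real analysis *)

(** While capacity is scarce the range for the larger capacity is [[q2 1, 1]], and every quality is
    at most 1, so the inclusion reduces to [q2 1 <= q1 1]. The obstacle is that [w 0] may be
    infinite. Then [phi] has no meaning at the value 1, its order and convexity hold only below 1,
    and raised allocations must stay below 1 and remain integrable. Type 1 is left out of the
    integrals, taken over [[0, 1[], because that single type may still be given quality 0. Slopes of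
    [phi] are slopes of chords: Cauchy's mean value theorem turns them into values of [w' / v'], and
    strict convexity separates adjacent chords. A truncation then amounts to comparing the virtual
    valuation [g / f] with the multiplier times a chord slope, a comparison that continuity extends
    from one type to its neighbours. *)

Lemma measurable_fun_ndecr_itv (R : realType) (i : interval R) (f : R -> R) :
  {in i &, {homo f : x y / x <= y}} -> measurable_fun [set` i] f.
Proof.
move=> f_nd.
apply: (measurability (@RGenCInfty.G R)) => //.
  exact: RGenCInfty.measurableE.
move=> /= _ [_] [r] -> <-.
apply: is_interval_measurable => s t/= [si +] [ti _] u /andP[su ut].
have ui : u \in i by apply: (@interval_is_interval _ i s t) => //; rewrite su.
rewrite /= in_itv/= andbT => fs; split => //.
by rewrite in_itv/= andbT (le_trans fs)// f_nd.
Qed.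

(** A nonnegative function of integral 0 vanishes almost everywhere, while []a, b[] has positive
    measure. *)
Lemma Rintegral_gt0 (R : realType) (i : interval R) (h : R -> R) (a b : R) :
  lebesgue_measure.-integrable [set` i] (EFin \o h) ->
  (forall t, t \in i -> 0 <= h t) -> a < b ->
  (forall t, a < t < b -> t \in i /\ 0 < h t) ->
  0 < \int[lebesgue_measure]_(t in [set` i]) h t.
Proof.
move=> ih h0 ab hab; rewrite lt_neqAle Rintegral_ge0 ?andbT//; apply/eqP => I0.
have : ae_eq lebesgue_measure [set` i] (EFin \o h) (cst 0%E).
  apply/ae_eq_integral_abs => //; first exact: (measurable_int lebesgue_measure).
  rewrite -[RHS]/(0%:E) I0 /Rintegral fineK//; last exact: integrable_fin_num.
  by apply: eq_integral => t; rewrite inE/= => ti; rewrite ger0_norm// h0.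
move=> [N [mN N0]] sN.
have : (lebesgue_measure `]a, b[%classic <= lebesgue_measure N)%E.
  apply: le_measure; rewrite ?inE//=.
  move=> t/=; rewrite in_itv/= => /hab[ti ht0]; apply: sN => /=.
  by move=> /(_ ti) [] /eqP; rewrite gt_eqF.
rewrite N0 lebesgue_measure_itv/= lte_fin ab -EFinB lee_fin; lra.
Qed.

(* On a uniform subdivision the increments of [d] telescope to at most
   [(x b - x a) (b - a) / n]. *)
Lemma constant_of_monotone_slope (R : realType) (d x : R -> R) (a b : R) :
  a <= b ->
  (forall s t, a <= s -> s <= t -> t <= b ->
     `|d t - d s| <= (x t - x s) * (t - s)) ->
  d b = d a.
Proof.
move=> ab dx; apply/eqP; rewrite -subr_eq0 -normr_le0.
apply/ler_addgt0Pr => e e0; rewrite add0r.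
have [n nP] : exists n : nat, (x b - x a) * (b - a) <= e * n.+1%:R.
  exists (Num.truncn ((x b - x a) * (b - a) / e)).
  by rewrite [e * _]mulrC -ler_pdivrMr// ltW// truncnS_gt.
have n0 : (0 : R) < n.+1%:R by rewrite ltr0n.
pose u (k : nat) : R := a + k%:R * ((b - a) / n.+1%:R).
have u0 : u 0%N = a by rewrite /u mul0r addr0.
have un : u n.+1 = b by rewrite /u mulrCA divff ?gt_eqF// mulr1 subrKC.
have uS k : u k.+1 = u k + (b - a) / n.+1%:R by rewrite /u -natr1 mulrDl mul1r addrA.
have st0 : 0 <= (b - a) / n.+1%:R by rewrite divr_ge0 ?subr_ge0// ltW.
have au k : a <= u k by rewrite lerDl mulr_ge0.
have ub k : (k <= n.+1)%N -> u k <= b.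
  by move=> kn; rewrite -un lerD2l ler_wpM2r// ler_nat.
have tel k : (k <= n.+1)%N ->
    `|d (u k) - d a| <= (x (u k) - x a) * ((b - a) / n.+1%:R).
  elim: k => [_|k IH kn]; first by rewrite u0 !subrr normr0 mul0r.
  have E : u k.+1 - u k = (b - a) / n.+1%:R by rewrite uS addrAC subrr add0r.
  have := dx (u k) (u k.+1) (au k); rewrite E uS lerDl -uS => /(_ st0 (ub _ kn)).
  have {IH} := IH (ltnW kn).
  have := ler_distD (d (u k)) (d (u k.+1)) (d a).
  by set h := _ / _; nra.
have := tel n.+1 (leqnn _); rewrite un => /le_trans; apply.
by rewrite mulrA ler_pdivrMr.
Qed.

Lemma le_integrable_EFin (R : realType) (D : set R) (f g : R -> R) :
  measurable D -> measurable_fun D f -> (forall t, D t -> `|f t| <= `|g t|) ->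
  lebesgue_measure.-integrable D (EFin \o g) ->
  lebesgue_measure.-integrable D (EFin \o f).
Proof.
move=> mD mf fg; apply: (@le_integrable _ _ _ lebesgue_measure D mD (EFin \o f)).
  exact/measurable_EFinP.
by move=> t Dt; rewrite lee_fin; exact: fg.
Qed.

Lemma measurable_integrable (R : realType) (D : set R) (f : R -> R) :
  lebesgue_measure.-integrable D (EFin \o f) -> measurable_fun D f.
Proof. by move=> /measurable_int /measurable_EFinP. Qed.

Lemma integrable_Rintegral_lin (R : realType) (D : set R) (l1 l2 : R)
    (h1 h2 : R -> R) : measurable D ->
  lebesgue_measure.-integrable D (EFin \o h1) ->
  lebesgue_measure.-integrable D (EFin \o h2) ->
  lebesgue_measure.-integrable D (EFin \o (fun t => l1 * h1 t + l2 * h2 t)) /\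
  \int[lebesgue_measure]_(t in D) (l1 * h1 t + l2 * h2 t) =
    l1 * \int[lebesgue_measure]_(t in D) h1 t +
    l2 * \int[lebesgue_measure]_(t in D) h2 t.
Proof.
move=> mD i1 i2.
have j l h : lebesgue_measure.-integrable D (EFin \o h) ->
    lebesgue_measure.-integrable D (EFin \o (fun t => l * h t)).
  by move=> ih; exact: (@integrableZl _ _ _ lebesgue_measure _ mD l _ ih).
split; first exact: (@integrableD _ _ _ lebesgue_measure _ mD _ _ (j l1 _ i1) (j l2 _ i2)).
by rewrite RintegralD//; [|exact: j|exact: j]; rewrite !RintegralZl.
Qed.

Lemma within_continuous_gt (R : realType) (a b c m : R) (h : R -> R) :
  {within `[a, b], continuous h} -> a <= m <= b -> c < h m ->
  exists2 e, 0 < e & forall t, a <= t <= b -> `|t - m| < e -> c < h t.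
Proof.
move=> hc mab cm.
have /subspace_continuousP/(_ m) := hc.
move=> /(_ _)/cvgr_gt; rewrite /= in_itv/= => /(_ mab c cm).
rewrite near_withinE => -[e /= e0 eh]; exists e => // t tab te.
apply: eh; last by rewrite in_itv.
by rewrite /ball_/= distrC.
Qed.

(** * Optimal allocations *)

Section screening.
Context (R : realType) (f g phi : R -> R) (fin : Prop).

Notation D := (`[0%R, 1%R[%classic : set R).

(** [fin] stands for finiteness of [w 0]. Without it the value 1, that of quality 0, costs infinite
    capacity and [phi 1] is a junk value. *)
Definition served (a : R) : Prop := 0 <= a <= 1 /\ (a < 1 \/ fin).

Definition allocation (x : R -> R) : Prop :=
  [/\ forall s t : R, 0 <= s -> s <= t -> t <= 1 -> x s <= x t,
      forall t : R, 0 <= t <= 1 -> 0 <= x t <= 1,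
      forall t : R, 0 <= t < 1 -> x t < 1 \/ fin
    & lebesgue_measure.-integrable D (EFin \o (fun t => phi (x t) * f t))].

Definition yield (x : R -> R) : R := \int[lebesgue_measure]_(t in D) (x t * g t).

Definition load (x : R -> R) : R :=
  \int[lebesgue_measure]_(t in D) (phi (x t) * f t).

Definition optimal_allocation (C : R) (x : R -> R) : Prop :=
  [/\ allocation x, load x <= C
    & forall y, allocation y -> load y <= C -> yield y <= yield x].

Context (f_gt0 : forall t : R, 0 <= t <= 1 -> 0 < f t).
Context (f_int : lebesgue_measure.-integrable D (EFin \o f)).
Context (g_int : lebesgue_measure.-integrable D (EFin \o g)).
Context (phi0 : phi 0 = 0).
Context (phi_homo : forall a b : R, 0 <= a -> a <= b -> served b -> phi a <= phi b).
Context (phi_conv : forall a b c : R, 0 <= a -> a < b -> b < c -> served c ->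
  (phi b - phi a) * (c - b) < (phi c - phi b) * (b - a)).

Let phi_ge0 a : served a -> 0 <= phi a.
Proof.
move=> [/andP[a0 a1] af]; rewrite -phi0.
by apply: phi_homo => //; split => //; rewrite a0.
Qed.

Let mD : measurable D. Proof. exact: measurable_itv. Qed.

Let served_alloc (x : R -> R) (t : R) : allocation x -> 0 <= t < 1 -> served (x t).
Proof.
move=> [_ x01 xf _] t01; split; last exact: xf.
by apply: x01; lra.
Qed.

Lemma phi_convex (l a b : R) : 0 <= l <= 1 -> served a -> served b ->
  phi (l * a + (1 - l) * b) <= l * phi a + (1 - l) * phi b.
Proof.
wlog ab : l a b / a <= b.
  move=> W l01 sa sb; have [ab|ba] := leP a b; first exact: (W l a b ab l01 sa sb).
  have l01' : 0 <= 1 - l <= 1 by lra.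
  by have := W (1 - l) b a (ltW ba) l01' sb sa; rewrite subKr ![(1 - l) * _ + _]addrC.
move=> /andP[l0 l1] sa sb.
have [->|ab'] := eqVneq a b; first by rewrite -!mulrDl subrKC !mul1r.
have {ab ab'} ab : a < b by rewrite lt_neqAle ab' ab.
move: l0; rewrite le_eqVlt => /orP[/eqP<-|l0].
  by rewrite !mul0r !add0r subr0 !mul1r.
move: l1; rewrite le_eqVlt => /orP[/eqP->|l1].
  by rewrite subrr !mul0r !addr0 !mul1r.
have [/andP[a0 _] _] := sa.
set c := l * a + _.
have ac : a < c by rewrite /c; nra.
have cb : c < b by rewrite /c; nra.
have := phi_conv a0 ac cb sb.
have -> : b - c = l * (b - a) by rewrite /c; ring.
have -> : c - a = (1 - l) * (b - a) by rewrite /c; ring.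
rewrite !mulrA ltr_pM2r ?subr_gt0//; nra.
Qed.

Let integrable_alloc x : allocation x ->
  lebesgue_measure.-integrable D (EFin \o (fun t => x t * g t)).
Proof.
move=> [x_nd x01 _ _]; apply: le_integrable_EFin g_int => //.
  apply: measurable_funM; last exact: measurable_integrable.
    apply: measurable_fun_ndecr_itv => s t; rewrite !in_itv/= => /andP[s0 s1] /andP[t0 t1] st.
    by apply: x_nd => //; exact: ltW.
move=> t/=; rewrite in_itv/= => /andP[t0 t1].
have /andP[xt0 xt1] : 0 <= x t <= 1 by apply: x01; rewrite t0 ltW.
by rewrite normrM ger0_norm// ler_piMl.
Qed.

Let integrable_load x : allocation x ->
  lebesgue_measure.-integrable D (EFin \o (fun t => phi (x t) * f t)).
Proof. by case. Qed.

(** Mixtures, truncations and the single class all get their integrability from here: [phi \o y] is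
    nondecreasing, hence measurable, and a bound [h] of integrable load does the rest. *)
Lemma allocation_dominated (h y : R -> R) :
  lebesgue_measure.-integrable D (EFin \o (fun t => h t * f t)) ->
  (forall s t : R, 0 <= s -> s <= t -> t <= 1 -> y s <= y t) ->
  (forall t : R, 0 <= t <= 1 -> 0 <= y t <= 1) ->
  (forall t : R, 0 <= t < 1 -> y t < 1 \/ fin) ->
  (forall t : R, 0 <= t < 1 -> phi (y t) <= h t) ->
  allocation y.
Proof.
move=> ih y_nd y01 yf yh; split => //.
have sy (t : R) : 0 <= t < 1 -> served (y t).
  by move=> t01; split; [apply: y01; lra|exact: yf].
apply: le_integrable_EFin ih => //.
  apply: measurable_funM; last exact: measurable_integrable.
    apply: measurable_fun_ndecr_itv => s t; rewrite !in_itv/= => s01 t01 st.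
    apply: phi_homo; [|by apply: y_nd; lra|exact: sy].
    by have /andP[] : 0 <= y s <= 1 by apply: y01; lra.
move=> t/=; rewrite in_itv/= => t01.
have ft : 0 < f t by apply: f_gt0; lra.
have := phi_ge0 (sy _ t01); have := yh _ t01 => H1 H2.
rewrite !normrM ler_wpM2r// ger0_norm// (le_trans H1)// ler_norm//.
Qed.

(* A value of the Lagrange multiplier is the largest slope
   [(yield y - yield x) / (load y - C)] over the allocations [y] with load
   above [C]; concavity of the value of the problem in [C] makes it work also
   for the loads below [C]. *)
Lemma lagrange_multiplier (C : R) (x : R -> R) : 0 < C -> optimal_allocation C x ->
  exists2 mu, 0 <= mu &
    forall y, allocation y -> yield y - yield x <= mu * (load y - C).
Proof.
move=> C0 [xA xC x_opt].
have concave y z : allocation y -> allocation z -> C < load y -> load z < C ->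
    (yield y - yield x) * (C - load z) <= (yield x - yield z) * (load y - C).
  move=> yA zA Cy zC.
  (* The weight for which the loads average to [C]; by convexity of [phi] the mixture of [y] and [z]
     then has load at most [C]. *)
  pose l := (C - load z) / (load y - load z).
  have yz : 0 < load y - load z by lra.
  have l01 : 0 <= l <= 1.
    by apply/andP; split; [apply: divr_ge0; lra|rewrite ler_pdivrMr//; lra].
  pose u t := l * y t + (1 - l) * z t.
  have [iu iuE] := integrable_Rintegral_lin l (1 - l) mD (integrable_load yA) (integrable_load zA).
  have [_ ryE] := integrable_Rintegral_lin l (1 - l) mD (integrable_alloc yA) (integrable_alloc zA).
  have [y_nd y01 yf _] := yA; have [z_nd z01 zf _] := zA.
  have uh t : 0 <= t < 1 -> phi (u t) <= l * phi (y t) + (1 - l) * phi (z t).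
    by move=> t01; apply: phi_convex => //; exact: served_alloc.
  have uA : allocation u.
    apply: (@allocation_dominated (fun t => l * phi (y t) + (1 - l) * phi (z t))) => //.
    - by apply: eq_integrable iu => // t _ /=; congr EFin; ring.
    - move=> s t s0 st t1; have := y_nd s t s0 st t1; have := z_nd s t s0 st t1.
      by rewrite /u => ? ?; apply: lerD; rewrite ler_wpM2l//; lra.
    - by move=> t t01; have := y01 t t01; have := z01 t t01; rewrite /u; nra.
    - move=> t t01; have [yt|] := yf t t01; last by right.
      have [zt|] := zf t t01; last by right.
      left; rewrite /u; have /andP[] := l01; rewrite le_eqVlt => /orP[/eqP <-|l0] l1.
        by rewrite mul0r subr0 mul1r add0r.
      by nra.
  have Lu : load u <= C.
    apply: (@le_trans _ _ (l * load y + (1 - l) * load z)).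
      rewrite /load -iuE; apply: le_Rintegral => //; first exact: integrable_load.
      move=> t/=; rewrite in_itv/= => t01.
      have ft : 0 < f t by apply: f_gt0; lra.
      by have := uh t t01; nra.
    have E : l * (load y - load z) = C - load z by rewrite /l divfK// gt_eqF.
    lra.
  have := x_opt u uA Lu.
  have -> : yield u = l * yield y + (1 - l) * yield z.
    rewrite /yield -ryE; apply: eq_Rintegral => t _; rewrite /u; ring.
  have E : l * (load y - load z) = C - load z by rewrite /l divfK// gt_eqF.
  have -> : l * yield y + (1 - l) * yield z = yield z + l * (yield y - yield z) by ring.
  rewrite -(ler_pM2r yz) mulrDl -mulrA [X in l * X]mulrC mulrA E => H; nra.
(* The zero allocation has load 0, strictly below [C]. This strict feasibility bounds the slopes
   collected in [S]. *)
pose z0 : R -> R := cst 0.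
have z0L t : phi (z0 t) * f t = 0 by rewrite /z0 /= phi0 mul0r.
have z0A : allocation z0.
  split => //.
  - by move=> t _; rewrite /z0/= lexx ler01.
  - by move=> t _; left; rewrite /z0/=.
  - rewrite (_ : _ \o _ = cst 0%E); first exact: integrable0.
    by apply/funext => t /=; rewrite z0L.
have z0C : load z0 < C.
  rewrite /load; under eq_Rintegral do rewrite z0L.
  by rewrite Rintegral_cst// mul0r.
(* The element 0 makes the supremum nonnegative, and defined even if no allocation exceeds the load
   [C]. *)
pose S := [set m | m = 0 \/ exists y, [/\ allocation y, C < load y &
  m = (yield y - yield x) / (load y - C)]].
have S0 : S !=set0 by exists 0; left.
have x0 : yield z0 <= yield x by apply: x_opt => //; exact: ltW.
have ubS z : allocation z -> load z < C ->
    ubound S ((yield x - yield z) / (C - load z)).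
  move=> zA zC m [->|[y [yA Cy ->]]].
    by apply: divr_ge0; [rewrite subr_ge0; apply: x_opt => //; exact: ltW|lra].
  rewrite ler_pdivrMr ?subr_gt0// mulrAC ler_pdivlMr ?subr_gt0//.
  exact: concave.
have hS : has_sup S by split=> //; exists ((yield x - yield z0) / (C - load z0)); exact: ubS.
exists (sup S); first by apply: sup_ubound; [case: hS|left].
move=> y yA; case: (ltgtP (load y) C) => Cy.
- have := ge_sup S0 (ubS y yA Cy); rewrite ler_pdivlMr ?subr_gt0//; nra.
- have : (yield y - yield x) / (load y - C) <= sup S.
    by apply: sup_ubound; [case: hS|right; exists y].
  by rewrite ler_pdivrMr ?subr_gt0.
- by rewrite Cy subrr mulr0 subr_le0; apply: x_opt => //; rewrite Cy.
Qed.

(** Integrating the pointwise inequalities, strict on []a, b[], gives [yield y - yield x > mu *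
    (load y - load x)]. As [load x <= C], this contradicts the multiplier inequality for [y]. *)
Lemma no_improvement (C : R) (x : R -> R) (mu : R) (y : R -> R) (a b : R) :
  load x <= C -> 0 <= mu -> allocation x ->
  allocation y -> yield y - yield x <= mu * (load y - C) -> 0 <= a -> a < b -> b <= 1 ->
  (forall t : R, 0 <= t < 1 ->
     mu * ((phi (y t) - phi (x t)) * f t) <= (y t - x t) * g t) ->
  (forall t : R, a < t < b ->
     mu * ((phi (y t) - phi (x t)) * f t) < (y t - x t) * g t) -> False.
Proof.
move=> xC mu0 xA yA x_opt a0 ab b1 le_xy lt_xy.
have [i1 e1] := integrable_Rintegral_lin 1 (-1) mD (integrable_alloc yA) (integrable_alloc xA).
have [i2 e2] := integrable_Rintegral_lin 1 (-1) mD (integrable_load yA) (integrable_load xA).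
have [i3 e3] := integrable_Rintegral_lin 1 (- mu) mD i1 i2.
have : 0 < \int[lebesgue_measure]_(t in D) (1 * (1 * (y t * g t) + -1 * (x t * g t)) +
   - mu * (1 * (phi (y t) * f t) + -1 * (phi (x t) * f t))).
  apply: (Rintegral_gt0 i3 _ ab).
    by move=> t; rewrite in_itv/= => t01; have := le_xy t t01; nra.
  move=> t tab; split; first by rewrite in_itv/=; lra.
  by have := lt_xy t tab; nra.
rewrite e3 e1 e2 -!/(yield _) -!/(load _).
by move: x_opt; nra.
Qed.

(** * Chords of the strictly convex function [phi] *)

Lemma phi_gt0 (b : R) : 0 < b -> served b -> 0 < phi b.
Proof.
move=> b0 sb; rewrite lt_neqAle phi_ge0// andbT; apply/eqP => pb.
have hb : 0 < b / 2 < b by lra.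
have sh : served (b / 2) by case: sb => ? [?|?]; split; [lra|left; lra|lra|right].
(* If [phi b] were 0, strict convexity at the midpoint would make [phi (b / 2)] negative. *)
have := phi_ge0 sh; have := @phi_conv 0 (b / 2) b (lexx _).
rewrite phi0 -pb => /(_ _ _ sb); case/andP: hb => h1 h2 /(_ h1 h2); nra.
Qed.

Lemma chord_slope_gt0 (a b : R) : 0 <= a -> a < b -> served b -> phi a < phi b.
Proof.
move=> a0 ab sb; have [a0'|a0'] := eqVneq a 0.
  by rewrite a0' phi0; apply: phi_gt0 => //; rewrite -a0'.
have {a0 a0'} a0 : 0 < a by rewrite lt_neqAle eq_sym a0' a0.
have sa : served a by case: sb => ? [?|?]; split; [lra|left; lra|lra|right].
have := phi_gt0 a0 sa; have := @phi_conv 0 a b (lexx _) a0 ab sb.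
rewrite phi0; nra.
Qed.

(** With [chord_below] this plays the part of a tangent inequality: one slope, that of the chord
    over [[a, b]], prices every change of value above [b] or below [a]. *)
Lemma chord_above (a b c : R) : 0 <= a -> a < b -> b <= c -> served c ->
  (phi b - phi a) / (b - a) * (c - b) <= phi c - phi b.
Proof.
move=> a0 ab; rewrite le_eqVlt => /orP[/eqP <-|bc] sc.
  by rewrite !subrr mulr0.
rewrite mulrAC ler_pdivrMr ?subr_gt0//; apply/ltW/phi_conv => //.
Qed.

Lemma chord_below (a b c : R) : 0 <= c -> c <= a -> a < b -> served b ->
  phi a - phi c <= (phi b - phi a) / (b - a) * (a - c).
Proof.
move=> c0; rewrite le_eqVlt => /orP[/eqP ->|ca] ab sb.
  by rewrite !subrr mulr0.
rewrite mulrAC ler_pdivlMr ?subr_gt0//; apply/ltW/phi_conv => //.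
Qed.

(** * Truncated allocations *)

Definition lower (x : R -> R) (s b t : R) : R :=
  if t < s then Num.min (x t) b else x t.

Definition raise (x : R -> R) (s a t : R) : R :=
  if t < s then x t else Num.max (x t) a.

Lemma lower_allocation (x : R -> R) (s b : R) :
  0 <= b -> allocation x -> allocation (lower x s b).
Proof.
move=> b0 xA; have [x_nd x01 xf xi] := xA.
have lx t : lower x s b t <= x t.
  by rewrite /lower; case: ifP => // _; rewrite ge_min lexx.
have l01 t : 0 <= t <= 1 -> 0 <= lower x s b t <= 1.
  move=> t01; have := x01 t t01 => /andP[x0 x1].
  rewrite (le_trans (lx t) x1) andbT /lower; case: ifP => // _.
  by rewrite le_min x0 b0.
apply: (allocation_dominated xi) => //.
- move=> t1 t2 t10 t12 t21; have := x_nd t1 t2 t10 t12 t21 => x12.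
  rewrite /lower; case: ifPn => h1; case: ifPn => h2 => //.
  + by rewrite le_min !ge_min x12 lexx orbT.
  + by rewrite ge_min x12.
  + by lra.
- move=> t t01; have [xt|] := xf t t01; last by right.
  by left; exact: le_lt_trans (lx t) xt.
- move=> t t01; apply: phi_homo => //; last exact: served_alloc.
  by have /andP[] : 0 <= lower x s b t <= 1 by apply: l01; lra.
Qed.

Lemma raise_allocation (x : R -> R) (s a : R) :
  served a -> allocation x -> allocation (raise x s a).
Proof.
move=> sa xA; have [x_nd x01 xf xi] := xA; have [a01 af] := sa.
have [ri _] := integrable_Rintegral_lin 1 (phi a) mD xi f_int.
apply: (@allocation_dominated (fun t => phi (x t) + phi a)) => //.
- by apply: eq_integrable ri => // t _ /=; congr EFin; ring.
- move=> t1 t2 t10 t12 t21; have := x_nd t1 t2 t10 t12 t21 => x12.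
  rewrite /raise; case: ifPn => h1; case: ifPn => h2 => //.
  + by rewrite le_max x12.
  + by lra.
  + by rewrite ge_max !le_max x12 lexx orbT.
- move=> t t01; have := x01 t t01; rewrite /raise; case: ifP => // _.
  by case: (leP (x t) a).
- move=> t t01; have := xf t t01; rewrite /raise; case: ifP => // _.
  by case: (leP (x t) a).
- move=> t t01; have st := served_alloc xA t01.
  have := phi_ge0 st; have := phi_ge0 sa.
  by rewrite /raise; case: ifP => _; last case: (leP (x t) a) => _; lra.
Qed.

(** * Comparison of the best qualities *)

Context (f_cont : {within `[0, 1], continuous f}).
Context (g_cont : {within `[0, 1], continuous g}).

Let near_gt (k m : R) : 0 <= m <= 1 -> k * f m < g m ->
  exists2 e, 0 < e & forall t, 0 <= t <= 1 -> `|t - m| < e -> k * f t < g t.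
Proof.
move=> m01 km; have c : {within `[0, 1], continuous (fun t => g t - k * f t)}.
  move=> t; apply: cvgB; first exact: g_cont.
  by apply: cvgM; [exact: cvg_cst|exact: f_cont].
have [||e e0 he] := @within_continuous_gt _ _ _ 0 m _ c => //; first by lra.
by exists e => // t t01 te; have := he t t01 te; lra.
Qed.

Let near_lt (k m : R) : 0 <= m <= 1 -> g m < k * f m ->
  exists2 e, 0 < e & forall t, 0 <= t <= 1 -> `|t - m| < e -> g t < k * f t.
Proof.
move=> m01 km; have c : {within `[0, 1], continuous (fun t => k * f t - g t)}.
  move=> t; apply: cvgB; last exact: g_cont.
  by apply: cvgM; [exact: cvg_cst|exact: f_cont].
have [||e e0 he] := @within_continuous_gt _ _ _ 0 m _ c => //; first by lra.
by exists e => // t t01 te; have := he t t01 te; lra.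
Qed.

Context (g_lt_f : forall t : R, 0 <= t < 1 -> g t < f t).
Context (g1 : g 1 = f 1).

(* The multipliers satisfy [mu2 <= mu1]; let [k] be the slope of the chord of
   [phi] over [a, b]. If [mu1 * k >= 1], capping [x1] at [b] is an improvement;
   otherwise raising [x2] to [a] near the type 1 is one. *)
Lemma top_quality_mono (C1 C2 : R) (x1 x2 : R -> R) (s a b : R) :
  0 <= C1 -> C1 < C2 ->
  optimal_allocation C1 x1 -> optimal_allocation C2 x2 ->
  0 <= a -> a < b -> b < 1 -> x2 1 < a ->
  0 <= s -> s < 1 -> (forall t, s < t < 1 -> b < x1 t) -> False.
Proof.
move=> C10 C12 o1 o2 a0 ab b1 x2a s0 s1 x1b.
have [A1 L1 _] := o1; have [A2 L2 _] := o2.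
have [x1_nd x101 x1f _] := A1; have [x2_nd x201 x2f _] := A2.
have sb : served b by split; [lra|left].
have sa : served a by split; [lra|left; lra].
(* The types above [s] receive positive value and so use capacity; a multiplier exists only for
   positive capacity. *)
have {C10} C10 : 0 < C1.
  rewrite (lt_le_trans _ L1)//; apply: (Rintegral_gt0 (integrable_load A1) _ s1).
    move=> t; rewrite in_itv/= => t01.
    have ft : 0 < f t by apply: f_gt0; lra.
    by rewrite mulr_ge0//; [exact: phi_ge0 (served_alloc A1 t01)|exact: ltW].
  move=> t st; rewrite in_itv/=; split; first by lra.
  have t01 : 0 <= t < 1 by lra.
  rewrite mulr_gt0// ?f_gt0//; last by lra.
  by apply: phi_gt0; [have := x1b t st; lra|exact: served_alloc].
have C20 : 0 < C2 by lra.
have [mu1 mu10 m1] := lagrange_multiplier C10 o1.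
have [mu2 mu20 m2] := lagrange_multiplier C20 o2.
(* Testing each optimum against the other and adding gives [0 <= (mu1 - mu2) * (C2 - C1)]. *)
have mu21 : mu2 <= mu1 by have := m1 _ A2; have := m2 _ A1; nra.
set k := (phi b - phi a) / (b - a).
have k0 : 0 <= k by rewrite divr_ge0// subr_ge0 ltW// chord_slope_gt0.
have [mk|mk] := leP 1 (mu1 * k).
  have yA : allocation (lower x1 2 b) by apply: lower_allocation => //; lra.
  (* Each unit of value cut above [b] saves capacity worth at least [mu1 * k >= 1], while it earns
     [g / f < 1]. The threshold 2 lies beyond all types, so the cap applies to every type. *)
  have lt_imp t : 0 <= t < 1 -> b < x1 t ->
      mu1 * ((phi b - phi (x1 t)) * f t) < (b - x1 t) * g t.
    move=> t01 bx; have ft : 0 < f t by apply: f_gt0; lra.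
    have := chord_above a0 ab (ltW bx) (served_alloc A1 t01).
    rewrite -/k => H; have := g_lt_f t01 => gf.
    have H2 : mu1 * (phi b - phi (x1 t)) <= b - x1 t by nra.
    nra.
  apply: (no_improvement L1 mu10 A1 yA (m1 _ yA) s0 s1 (lexx 1)).
    move=> t t01; rewrite /lower (_ : t < 2); last by lra.
    by case: (leP (x1 t) b) => bx; [rewrite !subrr !mul0r mulr0|exact/ltW/lt_imp].
  move=> t st; have bx := x1b t st; rewrite /lower (_ : t < 2); last by lra.
  by rewrite min_r ?(ltW bx)//; apply: lt_imp => //; lra.
(* At type 1 the virtual valuation [g / f] equals 1, which now exceeds [mu1 * k]. *)
have [e e0 he] : exists2 e, 0 < e &
    forall t, 0 <= t <= 1 -> `|t - 1| < e -> (mu1 * k) * f t < g t.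
  apply: near_gt; first by lra.
  by rewrite g1 gtr_pMl// f_gt0// ler01 lexx.
pose s' := Num.max 0 (1 - e / 2).
have s'0 : 0 <= s' by rewrite /s' le_max lexx.
have s'1 : s' < 1 by rewrite /s' gt_max; lra.
have yA : allocation (raise x2 s' a) by exact: raise_allocation.
have x2a' t : 0 <= t < 1 -> x2 t <= x2 1 by move=> t01; apply: x2_nd; lra.
have lt_imp t : s' <= t < 1 ->
    mu2 * ((phi (Num.max (x2 t) a) - phi (x2 t)) * f t) < (Num.max (x2 t) a - x2 t) * g t.
  move=> st; have t01 : 0 <= t < 1 by lra.
  have ft : 0 < f t by apply: f_gt0; lra.
  have xta := x2a' t t01.
  rewrite max_r; last by lra.
  have x20 : 0 <= x2 t by have /andP[] : 0 <= x2 t <= 1 by apply: x201; lra.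
  have := chord_below x20 (_ : x2 t <= a) ab sb; rewrite -/k => H.
  have {}H : phi a - phi (x2 t) <= k * (a - x2 t) by apply: H; lra.
  have ge : mu1 * k * f t < g t.
    apply: he; first by lra.
    have /andP[] := st; rewrite /s' ge_max => /andP[_ h1] h2.
    by rewrite ltr0_norm; lra.
  have H2 : mu2 * (phi a - phi (x2 t)) <= mu1 * k * (a - x2 t).
    apply: (@le_trans _ _ (mu2 * (k * (a - x2 t)))); first by rewrite ler_wpM2l.
    by rewrite mulrA ler_wpM2r// ?ler_wpM2r//; lra.
  have H3 : mu2 * (phi a - phi (x2 t)) * f t <= mu1 * k * (a - x2 t) * f t.
    by rewrite ler_wpM2r// ltW.
  nra.
apply: (no_improvement L2 mu20 A2 yA (m2 _ yA) s'0 s'1 (lexx 1)).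
  move=> t t01; rewrite /raise; case: ltP => st; first by rewrite !subrr !mul0r mulr0.
  by apply/ltW/lt_imp; lra.
by move=> t st; rewrite /raise; case: (ltP t s') => ts; [lra|apply: lt_imp; lra].
Qed.


(** * Scarce and saturating capacity *)

Context (t0 : R) (t0_in : 0 < t0 < 1).
Context (g_lt0 : forall t : R, 0 <= t < t0 -> g t < 0).
Context (g_t0 : g t0 = 0).
Context (g_gt0 : forall t : R, t0 < t < 1 -> 0 < g t).

(* The class [q = 0], of value 1, sold to the types above [t0]. *)
Definition single_class (t : R) : R := if t <= t0 then 0 else 1.

Lemma single_class_allocation : fin -> allocation single_class.
Proof.
move=> finT; have s1 : served 1 by split; [lra|right].
have [ri _] := integrable_Rintegral_lin (phi 1) 0 mD f_int f_int.
apply: (@allocation_dominated (fun=> phi 1)) => //.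
- by apply: eq_integrable ri => // t _ /=; congr EFin; ring.
- move=> s t _ st _; rewrite /single_class.
  by case: (leP s t0) => h1; case: (leP t t0) => h2; lra.
- by move=> t _; rewrite /single_class; case: ifP => _; rewrite ?lexx ?ler01.
- by move=> t _; right.
- move=> t _; rewrite /single_class; case: ifP => _ //.
  by rewrite phi0 phi_ge0.
Qed.

(** If capacity were free, raising [x] would pay wherever [g] is positive, so [x] would be 1 on
    []t0, 1[]. Then [w 0] is finite and the load of [x] is at least that of the single class, which
    exceeds [C]. *)
Lemma multiplier_gt0 (C mu : R) (x : R -> R) :
  (fin -> C < load single_class) -> 0 <= mu -> load x <= C -> allocation x ->
  (forall y, allocation y -> yield y - yield x <= mu * (load y - C)) ->
  0 < mu.
Proof.
have t01' := t0_in.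
move=> unsat mu0 xC xA x_opt; rewrite lt_neqAle mu0 andbT; apply/eqP => muE.
have [x_nd x01 xf xi] := xA.
have x1 (t1 : R) : t0 < t1 < 1 -> 1 <= x t1.
  move=> t11; rewrite leNgt; apply/negP => xt1.
  have /andP[xt10 _] : 0 <= x t1 <= 1 by apply: x01; lra.
  (* Halfway between [x t1] and 1: the raised value stays below 1 and is therefore served even if
     [w 0] is infinite. *)
  pose a := (1 + x t1) / 2.
  have sa : served a by split; [rewrite /a; lra|left; rewrite /a; lra].
  have yA : allocation (raise x t0 a) by exact: raise_allocation.
  apply: (no_improvement xC mu0 xA yA (x_opt _ yA) (_ : 0 <= t0) (_ : t0 < t1)); try lra.
  - move=> t t01; rewrite -muE mul0r /raise; case: (ltP t t0) => tt0.
      by rewrite subrr mul0r.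
    have [->|tt0'] := eqVneq t t0; first by rewrite g_t0 mulr0.
    have gt : 0 < g t by apply: g_gt0; rewrite lt_neqAle eq_sym tt0' tt0; lra.
    by rewrite mulr_ge0 ?(ltW gt)// subr_ge0 le_max lexx.
  - move=> t tt; rewrite -muE mul0r /raise; case: (ltP t t0) => tt0; first by lra.
    have gt : 0 < g t by apply: g_gt0; lra.
    have xt : x t <= x t1 by apply: x_nd; lra.
    by rewrite mulr_gt0// subr_gt0 lt_max; apply/orP; right; rewrite /a; lra.
have finT : fin.
  have := x1 ((t0 + 1) / 2) (ltac:(lra)); have [|] := xf ((t0 + 1) / 2) (ltac:(lra)) => //; lra.
have yA := single_class_allocation finT.
suff : load single_class <= load x by have := unsat finT; lra.
apply: le_Rintegral => //; [exact: integrable_load|].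
move=> t/=; rewrite in_itv/= => t01; have ft : 0 < f t by apply: f_gt0; lra.
rewrite ler_wpM2r ?(ltW ft)//; apply: phi_homo; last exact: served_alloc.
  by rewrite /single_class; case: ifP => _; lra.
rewrite /single_class; case: (leP t t0) => tt0; last by apply: x1; lra.
by have /andP[] : 0 <= x t <= 1 by apply: x01; lra.
Qed.

(** Types below [t0] have negative marginal revenue: dropping them raises the yield and frees
    capacity. A positive [s] is asked for so that the marginal user lies above 0, leaving types to
    its left on which to fill a jump. *)
Lemma exists_excluded (C : R) (x : R -> R) : 0 < C -> optimal_allocation C x ->
  exists2 s, 0 < s <= 1 & x s = 0.
Proof.
have t01' := t0_in.
move=> C0 ox; have [xA xC _] := ox; have [x_nd x01 xf xi] := xA.
have [mu mu0 x_opt] := lagrange_multiplier C0 ox.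
apply: contrapT => noex; have yA := lower_allocation t0 (lexx 0) xA.
apply: (no_improvement xC mu0 xA yA (x_opt _ yA) (_ : 0 <= 0) (_ : 0 < t0)); try lra.
- move=> t t01; rewrite /lower; case: (ltP t t0) => tt0; last first.
    by rewrite !subrr !mul0r mulr0.
  have /andP[xt0 _] : 0 <= x t <= 1 by apply: x01; lra.
  rewrite min_r// phi0 !sub0r.
  have ft : 0 < f t by apply: f_gt0; lra.
  have gt : g t < 0 by apply: g_lt0; lra.
  have := phi_ge0 (served_alloc xA t01) => pt.
  have : 0 <= mu * (phi (x t) * f t) by rewrite mulr_ge0// mulr_ge0// ltW.
  nra.
- move=> t tt0; have t01 : 0 <= t < 1 by lra.
  have /andP[xt0 _] : 0 <= x t <= 1 by apply: x01; lra.
  rewrite /lower (_ : t < t0); last by lra.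
  rewrite min_r// phi0 !sub0r.
  have ft : 0 < f t by apply: f_gt0; lra.
  have gt : g t < 0 by apply: g_lt0; lra.
  have := phi_ge0 (served_alloc xA t01) => pt.
  have : 0 <= mu * (phi (x t) * f t) by rewrite mulr_ge0// mulr_ge0// ltW.
  have : x t != 0.
    by apply/eqP => xt; apply: noex; exists t => //; lra.
  rewrite neq_lt => /orP[|xt]; first by lra.
  nra.
Qed.

(* At a jump of an optimal allocation at [m] from [0] to at least [a'], filling
   the jump from the left gives [g m <= mu * k f m] for the slope [k] of [phi]
   over [0, a'/2], and cutting it from the right gives [mu * k' f m <= g m] for
   the slope [k' > k] over [a'/2, a']. *)
Lemma no_jump (C : R) (x : R -> R) (m a' : R) :
  (fin -> C < load single_class) -> 0 < C -> optimal_allocation C x ->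
  0 < m < 1 -> 0 < a' < 1 -> (forall t, 0 <= t < m -> x t = 0) ->
  (forall t, m <= t <= 1 -> a' < x t) -> False.
Proof.
move=> unsat C0 ox m01 a01 xm0 xma.
have [xA xC _] := ox; have [x_nd x01 xf xi] := xA.
have [mu mu0 x_opt] := lagrange_multiplier C0 ox.
(* Scarcity enters here: a positive multiplier keeps [mu * k] and [mu * k'] apart. *)
have {}mu0 : 0 < mu := multiplier_gt0 unsat mu0 xC xA x_opt.
have sa' : served a' by split; [lra|left; lra].
pose a := a' / 2; have a0 : 0 < a by rewrite /a; lra.
have aa' : a < a' by rewrite /a; lra.
have sa : served a by split; [lra|left; lra].
set k := (phi a - phi 0) / (a - 0); set k' := (phi a' - phi a) / (a' - a).
have kk' : k < k'.
  rewrite /k /k' ltr_pdivrMr ?subr_gt0// mulrAC ltr_pdivlMr ?subr_gt0//.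
  exact: phi_conv.
have k'E : phi a' - phi a = k' * (a' - a) by rewrite /k' divfK// subr_eq0 gt_eqF.
have kE : phi a = k * a by rewrite /k phi0 !subr0 divfK// gt_eqF.
have fm : 0 < f m by apply: f_gt0; lra.
have H1 : g m <= mu * k * f m.
  rewrite leNgt; apply/negP => H.
  have [|e e0 he] := @near_gt (mu * k) m _ H; first by lra.
  pose s := Num.max 0 (m - e / 2).
  have s0 : 0 <= s by rewrite /s le_max lexx.
  have sm : s < m by rewrite /s gt_max; lra.
  have yA : allocation (raise x s a) by exact: raise_allocation.
  have main t : s <= t < m -> mu * ((phi (raise x s a t) - phi (x t)) * f t) <
      (raise x s a t - x t) * g t.
    move=> st; rewrite /raise; case: (ltP t s) => ts; first by lra.
    have -> : x t = 0 by apply: xm0; lra.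
    rewrite max_r ?(ltW a0)// phi0 !subr0 kE.
    have : mu * k * f t < g t.
      apply: he; first by lra.
      have /andP[] := st; rewrite /s ge_max => /andP[_ h1] h2.
      by rewrite ltr0_norm; lra.
    nra.
  apply: (no_improvement xC (ltW mu0) xA yA (x_opt _ yA) s0 sm); first by lra.
    move=> t t01; have [st|st] := boolP (s <= t < m); first exact/ltW/main.
    rewrite /raise; case: (ltP t s) => ts; first by rewrite !subrr !mul0r mulr0.
    rewrite max_l; first by rewrite !subrr !mul0r mulr0.
    have tm : m <= t by rewrite leNgt; apply: contra st => ->; rewrite ts.
    by have := xma t; lra.
  by move=> t st; apply: main; lra.
have H2 : mu * k' * f m <= g m.
  rewrite leNgt; apply/negP => H.
  have [|e e0 he] := @near_lt (mu * k') m _ H; first by lra.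
  pose s := Num.min 1 (m + e / 2).
  have s0 : s <= 1 by rewrite /s ge_min lexx.
  have sm : m < s by rewrite /s lt_min; lra.
  have yA : allocation (lower x s a') by apply: lower_allocation => //; lra.
  have main t : m <= t < s -> a' < x t -> mu * ((phi a' - phi (x t)) * f t) < (a' - x t) * g t.
    move=> st ax; have t01 : 0 <= t < 1 by lra.
    have := chord_above (ltW a0) aa' (ltW ax) (served_alloc xA t01); rewrite -/k' => Hk.
    have gt : g t < mu * k' * f t.
      apply: he; first by lra.
      have /andP[] := st; rewrite /s lt_min => h1 /andP[_ h2].
      by rewrite ger0_norm; lra.
    have ft : 0 < f t by apply: f_gt0; lra.
    have h1 : mu * (phi a' - phi (x t)) <= mu * (k' * (a' - x t)).
      by rewrite ler_wpM2l ?(ltW mu0)//; lra.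
    have h2 : mu * (phi a' - phi (x t)) * f t <= mu * (k' * (a' - x t)) * f t.
      by rewrite ler_wpM2r ?(ltW ft).
    nra.
  have m0 : 0 <= m by lra.
  apply: (no_improvement xC (ltW mu0) xA yA (x_opt _ yA) m0 sm s0).
    move=> t t01; rewrite /lower; case: (ltP t s) => ts; last first.
      by rewrite !subrr !mul0r mulr0.
    case: (leP (x t) a') => xt; first by rewrite !subrr !mul0r mulr0.
    apply/ltW/main => //; rewrite ts andbT leNgt; apply/negP => tm.
    by move: xt; rewrite xm0; lra.
  move=> t st; have ax : a' < x t by apply: xma; lra.
  rewrite /lower; case: (ltP t s) => ts; last by lra.
  by rewrite min_r ?(ltW ax)//; apply: main; lra.
have : mu * k * f m < mu * k' * f m by rewrite ltr_pM2r// ltr_pM2l.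
lra.
Qed.

(** The single class maximizes [x t * g t] type by type, by the sign of [g], so the multiplier 0
    works. If [x] differs from it at some [t] other than [t0], monotonicity spreads the difference
    to all types between [t] and [t0], and yield is lost. *)
Lemma saturated_allocation (C : R) (x : R -> R) :
  fin -> load single_class <= C -> optimal_allocation C x ->
  (forall t, 0 <= t < t0 -> x t = 0) /\ (forall t, t0 < t <= 1 -> x t = 1).
Proof.
have t01' := t0_in.
move=> finT satC [xA xC x_opt]; have [x_nd x01 xf xi] := xA.
have yA := single_class_allocation finT.
have y_le : yield single_class - yield x <= 0 * (load single_class - C).
  by rewrite mul0r subr_le0; exact: x_opt.
have y0 (t : R) : 0 <= t < 1 -> 0 * ((phi (single_class t) - phi (x t)) * f t) <=
    (single_class t - x t) * g t.
  move=> t01; have xt : 0 <= x t <= 1 by apply: x01; lra.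
  rewrite mul0r /single_class; case: (leP t t0) => tt0; last first.
    have gt : 0 < g t by apply: g_gt0; lra.
    by rewrite mulr_ge0 ?(ltW gt)//; lra.
  have [->|tt] := eqVneq t t0; first by rewrite g_t0 mulr0.
  have gt : g t < 0 by apply: g_lt0; rewrite lt_neqAle tt tt0; lra.
  nra.
split=> t tt.
  apply/eqP; rewrite -[_ == _]negbK; apply/negP => xt.
  have {}xt : 0 < x t.
    rewrite lt_neqAle eq_sym xt/=.
    by have /andP[] : 0 <= x t <= 1 by apply: x01; lra.
  apply: (no_improvement xC (lexx 0) xA yA y_le (_ : 0 <= t) (_ : t < t0) _ y0); try lra.
  move=> s ts; rewrite mul0r /single_class; case: (leP s t0) => st0; last by lra.
  have gs : g s < 0 by apply: g_lt0; lra.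
  have : x t <= x s by apply: x_nd; lra.
  nra.
have xt1 : 0 <= x t <= 1 by apply: x01; lra.
apply/eqP; rewrite -[_ == _]negbK; apply/negP => xt.
have {}xt : x t < 1 by rewrite lt_neqAle xt/=; lra.
apply: (no_improvement xC (lexx 0) xA yA y_le (_ : 0 <= t0) (_ : t0 < t) _ y0); try lra.
move=> s ts; rewrite mul0r /single_class; case: (leP s t0) => st0; first by lra.
have gs : 0 < g s by apply: g_gt0; lra.
have : x s <= x t by apply: x_nd; lra.
nra.
Qed.

End screening.

(** * Capacity as a function of the value of a quality *)

Section virtual_capacity.
Context (R : realType) (v : R -> R) (w : R -> \bar R).
Context (v_C1 : C1_on 0 1 v).
Context (v_decr : forall x y : R, 0 <= x -> x < y -> y <= 1 -> v y < v x).
Context (v0 : v 0 = 1) (v1 : v 1 = 0).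
Context (w_C1 : C1_capacity w).
Context (w_ge0 : forall x : R, 0 <= x <= 1 -> (0 <= w x)%E).
Context (w_decr : forall x y : R, 0 <= x -> x <= y -> y <= 1 -> (w y <= w x)%E).
Context (w1 : w 1 = 0%E).
Context (h_decr : forall x y : R, 0 < x -> x < y -> y < 1 ->
     virtual_capacity v w y < virtual_capacity v w x).

Definition quality (y : R) : R := xget 0 [set q | 0 <= q <= 1 /\ v q = y].

(** This is [phi], with [quality] as the inverse of [v]. At the value 1, [fine] turns an infinite
    [w 0] into 0, whence the restriction to [served] values. *)
Definition capacity_of_value (y : R) : R := fine (w (quality y)).

Lemma qualityP (y : R) : 0 <= y <= 1 -> 0 <= quality y <= 1 /\ v (quality y) = y.
Proof.
move=> y01; have [vc _ _] := v_C1.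
have [||c cI cy] := @IVT R v 0 1 y _ vc; [exact: ler01|by rewrite v0 v1 min_r ?max_l ?ler01|].
rewrite /quality; case: xgetP => [_ -> []//|/(_ c)[]].
by split => //; move: cI; rewrite in_itv.
Qed.

Lemma v_ndecr (x y : R) : 0 <= x -> x <= y -> y <= 1 -> v y <= v x.
Proof.
move=> x0; rewrite le_eqVlt => /orP[/eqP->//|xy] y1.
exact/ltW/v_decr.
Qed.

Lemma v_inj (x y : R) : 0 <= x <= 1 -> 0 <= y <= 1 -> v x = v y -> x = y.
Proof.
move=> x01 y01 vxy; case: (ltgtP x y) => // xy.
  have : v y < v x by apply: v_decr; lra.
  by rewrite vxy ltxx.
have : v x < v y by apply: v_decr; lra.
by rewrite vxy ltxx.
Qed.

Lemma v_01 (x : R) : 0 <= x <= 1 -> 0 <= v x <= 1.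
Proof.
move=> x01; have : v 1 <= v x by apply: v_ndecr; lra.
have : v x <= v 0 by apply: v_ndecr; lra.
by rewrite v0 v1 => -> ->.
Qed.

Lemma quality_v (q : R) : 0 <= q <= 1 -> quality (v q) = q.
Proof.
move=> q01; have [r01 rv] := qualityP (v_01 q01).
exact: v_inj.
Qed.

Lemma quality_decr (x y : R) : 0 <= x -> x < y -> y <= 1 -> quality y < quality x.
Proof.
move=> x0 xy y1.
have [|x01 xv] := @qualityP x; first by lra.
have [|y01 yv] := @qualityP y; first by lra.
rewrite ltNge; apply/negP => H.
have : v (quality y) <= v (quality x) by apply: v_ndecr; lra.
by rewrite xv yv leNgt xy.
Qed.

Let fin := w 0 \is a fin_num.

Lemma w_fin_num (q : R) : 0 <= q <= 1 -> 0 < q \/ fin -> w q \is a fin_num.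
Proof.
move=> /andP[q0 q1] [q0'|f0]; first by case: w_C1 => + _; apply; rewrite q0'.
move: q0; rewrite le_eqVlt => /orP[/eqP<-//|q0].
by case: w_C1 => + _; apply; rewrite q0.
Qed.

Lemma quality_served (y : R) : served fin y -> 0 < quality y \/ fin.
Proof.
move=> [y01 [y1|]]; last by right.
left; have [q01 qv] := qualityP y01; rewrite lt_neqAle; case/andP: (q01) => -> _.
by rewrite andbT; apply/eqP => q0; move: qv; rewrite -q0 v0 => yE; rewrite -yE ltxx in y1.
Qed.

Lemma w_quality (y : R) : served fin y ->
  w (quality y) = (capacity_of_value y)%:E.
Proof.
move=> sy; rewrite fineK//; apply: w_fin_num; last exact: quality_served.
by case: sy => /qualityP[].
Qed.

Lemma capacity_of_value0 : capacity_of_value 0 = 0.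
Proof. by rewrite /capacity_of_value -v1 quality_v ?w1// lexx ler01. Qed.

Lemma capacity_of_value1 : capacity_of_value 1 = fine (w 0).
Proof. by rewrite /capacity_of_value -{1}v0 quality_v// lexx ler01. Qed.

Lemma capacity_of_value_homo (a b : R) : 0 <= a -> a <= b -> served fin b ->
  capacity_of_value a <= capacity_of_value b.
Proof.
move=> a0 ab sb; have [b01 bf] := sb.
have sa : served fin a by split; [lra|case: bf => ?; [left; lra|right]].
rewrite -lee_fin -!w_quality//; move: ab; rewrite le_eqVlt => /orP[/eqP->//|ab].
have [|qa _] := @qualityP a; first by lra.
have [|qb _] := @qualityP b; first by lra.
by apply: w_decr; [lra| |lra]; apply/ltW/quality_decr; lra.
Qed.

Let w_regular (a b : R) : 0 <= a -> a < b -> b <= 1 -> 0 < a \/ fin ->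
  {within `[a, b], continuous (fine \o w)} /\
  (forall x, a < x < b -> derivable (fine \o w) x 1).
Proof.
move=> a0 ab b1 af.
suff [c [ca c1 [cw dw _]]] : exists c, [/\ 0 <= c <= a, a < 1 & C1_on c 1 (fine \o w)].
  split; first by apply: continuous_subspaceW cw; apply: subset_itv; rewrite bnd_simp; lra.
  by move=> x xab; apply: dw; lra.
have [_ [[f0 w01]|[w0oo _ wa]]] := w_C1.
  by exists 0; split => //; lra.
case: af => [a0'|]; last by rewrite /fin w0oo.
by exists a; split; [lra|lra|apply: wa; lra].
Qed.

Let dv_le0 (x : R) : 0 < x < 1 -> derive1 v x <= 0.
Proof.
move=> x01; have [_ dv _] := v_C1.
apply: (@decr_derive1_le0_itv _ v true false 0 1).
- by move=> y; rewrite inE/= => /dv.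
- move=> y z; rewrite !in_itv/= => yI zI yz; apply: v_decr; lra.
- by rewrite in_itv.
Qed.

(* At a zero of [v'] the quotient [w' / v'] is 0 by convention; being strictly
   decreasing it would be negative afterwards, so [w] would increase there. *)
Let dv_neq0 (x : R) : 0 < x < 1 -> derive1 v x != 0.
Proof.
move=> x01; apply/eqP => dv0.
(* The points cutting []x, 1[] into thirds: the mean value point between them lies strictly between
   [x] and 1, where [h_decr] applies. *)
pose a := (2 * x + 1) / 3; pose b := (x + 2) / 3.
have [||||wc dw] := @w_regular a b;
  [rewrite /a; lra|rewrite /a /b; lra|rewrite /b; lra|left; rewrite /a; lra|].
have ab : a < b by rewrite /a /b; lra.
have [y|y yab] := @MVT R (fine \o w) (derive1 (fine \o w)) a b ab _ wc.
  by rewrite in_itv/= derive1E => yab; exact/derivableP/dw.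
have {}yab : a < y < b by move: yab; rewrite in_itv.
have xy : x < y < 1 by rewrite /a /b in yab; lra.
have wba : fine (w b) <= fine (w a).
  have a0 : 0 < a by rewrite /a; lra.
  have b1 : b < 1 by rewrite /b; lra.
  apply: fine_le; [| |by apply: w_decr; lra].
    by apply: w_fin_num; [lra|left; lra].
  by apply: w_fin_num; [lra|left].
move=> /= E; have {wba} : derive1 (fine \o w) y <= 0.
  rewrite leNgt; apply/negP => dw0.
  have : 0 < derive1 (fine \o w) y * (b - a) by rewrite mulr_gt0// subr_gt0.
  by rewrite -E subr_gt0 ltNge wba.
move=> dwy; have := @h_decr x y; rewrite {2}/virtual_capacity dv0 invr0 mulr0.
move=> /(_ ltac:(lra) ltac:(lra) ltac:(lra)); apply/negP; rewrite -leNgt.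
rewrite /virtual_capacity -mulrNN mulr_ge0// ?oppr_ge0//.
by rewrite invr_le0 dv_le0//; lra.
Qed.

(** The quotient is a chord slope of [phi], and Cauchy's mean value theorem, applicable since [v']
    does not vanish, finds it among the values of [w' / v']. *)
Let h_slope (a b : R) : 0 <= a -> a < b -> b <= 1 -> 0 < a \/ fin ->
  exists2 x, a < x < b & virtual_capacity v w x =
    (fine (w b) - fine (w a)) / (v b - v a).
Proof.
move=> a0 ab b1 af; have [wc dw] := w_regular a0 ab b1 af.
have [vc dv _] := v_C1.
have vc' : {within `[a, b], continuous v}.
  by apply: continuous_subspaceW vc; apply: subset_itv; rewrite bnd_simp; lra.
have dwE x : x \in `]a, b[ -> is_derive x 1 (fine \o w) (derive1 (fine \o w) x).
  by rewrite in_itv/= => xab; rewrite derive1E; exact/derivableP/dw.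
have dvE x : x \in `]a, b[ -> is_derive x 1 v (derive1 v x).
  by rewrite in_itv/= => xab; rewrite derive1E; apply/derivableP/dv; lra.
have [|x xab xE] := cauchy_MVT ab wc vc' dwE dvE.
  by move=> x; rewrite in_itv/= => xab; apply: dv_neq0; lra.
by exists x; rewrite -?xE//; move: xab; rewrite in_itv.
Qed.

(** The two chord slopes are values of [w' / v']. As [quality] reverses the order, the chord over
    the larger values corresponds to the smaller quality, where [w' / v'] is larger. *)
Lemma capacity_of_value_convex (a b c : R) :
  0 <= a -> a < b -> b < c -> served fin c ->
  (capacity_of_value b - capacity_of_value a) * (c - b) <
  (capacity_of_value c - capacity_of_value b) * (b - a).
Proof.
move=> a0 ab bc sc; have [c01 _] := sc.
have [|qa va] := @qualityP a; first by lra.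
have [|qb vb] := @qualityP b; first by lra.
have [qc vc] := qualityP c01.
have qab : quality b < quality a by apply: quality_decr; lra.
have qbc : quality c < quality b by apply: quality_decr; lra.
have [||||x xcb xE] := @h_slope (quality c) (quality b); [lra|lra|lra|exact: quality_served|].
have [||||y yab yE] := @h_slope (quality b) (quality a); [lra|lra|lra|left; lra|].
have := @h_decr x y; rewrite xE yE vb va vc -!/(capacity_of_value _).
move=> /(_ ltac:(lra) ltac:(lra) ltac:(lra)).
rewrite -(opprB b a) -(opprB c b) !invrN !mulrN -!mulNr !opprB.
by rewrite ltr_pdivrMr ?subr_gt0// mulrAC ltr_pdivlMr ?subr_gt0.
Qed.

End virtual_capacity.

(** * Marginal revenue *)

Section virtual_valuation.
Context (R : realType) (f : R -> R) (t0 : R).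
Context (f_cont : {within `[0, 1], continuous f}).
Context (f_gt0 : forall t : R, 0 <= t <= 1 -> 0 < f t).
Context (f_density : cdf_of f 1 = 1).

(** The virtual valuation times the density, cleared of its division so that continuity and the
    value at 1 are immediate. *)
Definition marginal_revenue (t : R) : R := t * f t - (1 - cdf_of f t).

Lemma density_integrable : lebesgue_measure.-integrable `[0, 1] (EFin \o f).
Proof.
by apply: continuous_compact_integrable => //; exact: segment_compact.
Qed.

Let f_intS (i : interval R) : [set` i] `<=` `[0, 1] ->
  lebesgue_measure.-integrable [set` i] (EFin \o f).
Proof.
move=> s; apply: (@integrableS _ _ _ lebesgue_measure _ _ _ _ _ s density_integrable) => //.
Qed.

Lemma cdf0 : cdf_of f 0 = 0.
Proof. by rewrite /cdf_of set_itv1 Rintegral_set1. Qed.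

Lemma cdf_diff (s t : R) : 0 <= s -> s <= t -> t <= 1 ->
  \int[lebesgue_measure]_(x in `]s, t]) f x = cdf_of f t - cdf_of f s.
Proof.
move=> s0 st t1; rewrite /cdf_of -(@Rintegral_itvB _ _ (BLeft 0) (BRight t) s)//.
by apply: f_intS; apply: subset_itvl; rewrite bnd_simp.
Qed.

Lemma cdf_lt (s t : R) : 0 <= s -> s < t -> t <= 1 -> cdf_of f s < cdf_of f t.
Proof.
move=> s0 st t1; rewrite -subr_gt0 -cdf_diff//; last exact: ltW.
apply: (@Rintegral_gt0 _ _ _ s t) => //.
- by apply: f_intS => x/=; rewrite !in_itv/=; lra.
- by move=> x; rewrite in_itv/= => xst; apply/ltW/f_gt0; lra.
- by move=> x xst; split; [rewrite in_itv/=; lra|apply: f_gt0; lra].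
Qed.

Lemma cdf_continuous : {within `[0, 1], continuous (cdf_of f)}.
Proof. exact: (parameterized_integral_continuous ler01 density_integrable). Qed.

Lemma marginal_revenue_continuous : {within `[0, 1], continuous marginal_revenue}.
Proof.
have idc : {within `[0, 1], continuous (@id R)}.
  by apply: continuous_subspaceT => x; exact: cvg_id.
move=> t; apply: cvgB; first by apply: cvgM; [exact: idc|exact: f_cont].
by apply: cvgB; [exact: cvg_cst|exact: cdf_continuous].
Qed.

Lemma marginal_revenue_integrable :
  lebesgue_measure.-integrable `[0, 1] (EFin \o marginal_revenue).
Proof.
apply: continuous_compact_integrable; first exact: segment_compact.
exact: marginal_revenue_continuous.
Qed.

Lemma marginal_revenue_lt (t : R) : 0 <= t < 1 -> marginal_revenue t < f t.
Proof.
move=> t01; have ft : 0 < f t by apply: f_gt0; lra.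
have : cdf_of f t < 1 by rewrite -f_density; apply: cdf_lt; lra.
rewrite /marginal_revenue; nra.
Qed.

Lemma marginal_revenue1 : marginal_revenue 1 = f 1.
Proof. by rewrite /marginal_revenue f_density subrr subr0 mul1r. Qed.

Lemma marginal_revenueE (t : R) : 0 <= t <= 1 ->
  marginal_revenue t = virtual_valuation f t * f t.
Proof.
move=> t01; have ft : f t != 0 by rewrite gt_eqF// f_gt0.
by rewrite /virtual_valuation mulrBl divfK.
Qed.

Context (t0_in : 0 < t0 < 1) (t0_zero : virtual_valuation f t0 = 0).
Context (t0_uniq : forall t : R, 0 < t < 1 -> virtual_valuation f t = 0 -> t = t0).

Lemma marginal_revenue_t0 : marginal_revenue t0 = 0.
Proof.
have t01 := t0_in.
by rewrite marginal_revenueE ?t0_zero ?mul0r//; lra.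
Qed.

Let zero_uniq (t : R) : 0 < t < 1 -> marginal_revenue t = 0 -> t = t0.
Proof.
move=> t01; rewrite marginal_revenueE; last by lra.
move/eqP; rewrite mulf_eq0 => /orP[/eqP|]; first exact: t0_uniq.
by rewrite gt_eqF// f_gt0//; lra.
Qed.

Let marginal_revenue_ivt (a b : R) : 0 <= a -> a <= b -> b <= 1 ->
  marginal_revenue a <= 0 <= marginal_revenue b ->
  exists2 c, a <= c <= b & marginal_revenue c = 0.
Proof.
move=> a0 ab b1 /andP[ga gb].
have gc : {within `[a, b], continuous marginal_revenue}.
  apply: continuous_subspaceW marginal_revenue_continuous.
  by apply: subset_itv; rewrite bnd_simp.
have [|c cab c0] := @IVT _ _ _ _ 0 ab gc.
  by rewrite min_l ?max_r ?ga ?gb//; apply: le_trans gb.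
by exists c => //; rewrite -in_itv.
Qed.

(** The value at 0 is -1; by the intermediate value theorem a nonnegative value before [t0] would
    produce a second zero. The positive value [f 1] at 1 settles the other side in the same way. *)
Lemma marginal_revenue_lt0 (t : R) : 0 <= t < t0 -> marginal_revenue t < 0.
Proof.
have t01 := t0_in; move=> tt0.
have g0 : marginal_revenue 0 < 0 by rewrite /marginal_revenue cdf0; lra.
rewrite ltNge; apply/negP => gt.
have [||||c ct c0] := @marginal_revenue_ivt 0 t; [lra|lra|lra|by rewrite (ltW g0)|].
have : c != 0 by apply/eqP => cE; move: c0; rewrite cE; lra.
rewrite neq_lt => /orP[|cgt]; first by lra.
have c01 : 0 < c < 1 by lra.
by have := zero_uniq c01 c0; lra.
Qed.

Lemma marginal_revenue_gt0 (t : R) : t0 < t < 1 -> 0 < marginal_revenue t.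
Proof.
have t01 := t0_in; move=> tt0.
have g1 : 0 < marginal_revenue 1 by rewrite marginal_revenue1 f_gt0// ler01 lexx.
rewrite ltNge; apply/negP => gt.
have [||||c ct c0] := @marginal_revenue_ivt t 1; [lra|lra|lra|by rewrite gt (ltW g1)|].
have : c != 1 by apply/eqP => cE; move: c0; rewrite cE; lra.
rewrite neq_lt => /orP[clt|]; last by lra.
have c01 : 0 < c < 1 by lra.
by have := zero_uniq c01 c0; lra.
Qed.

End virtual_valuation.

(** * Information rent *)

Section information_rent.
Context (R : realType) (f x : R -> R).
Context (f_cont : {within `[0, 1], continuous f}).
Context (f_gt0 : forall t : R, 0 <= t <= 1 -> 0 < f t).
Context (f_density : cdf_of f 1 = 1).
Context (x_nd : forall s t : R, 0 <= s -> s <= t -> t <= 1 -> x s <= x t).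
Context (x01 : forall t : R, 0 <= t <= 1 -> 0 <= x t <= 1).

(** The utility of type [t] by the envelope theorem: its slope at type [s] is the value [x s] of the
    chosen quality, and type 0 gets nothing. *)
Definition rent (t : R) : R := \int[lebesgue_measure]_(s in `[0, t]) x s.

Let I := `[0%R, 1%R]%classic : set R.

Let mI : measurable I. Proof. exact: measurable_itv. Qed.

Let x_meas : measurable_fun I x.
Proof.
apply: measurable_fun_ndecr_itv => s t; rewrite !in_itv/= => s01 t01 st.
by apply: x_nd; lra.
Qed.

Let cst_int (c : R) (i : interval R) : [set` i] `<=` `[0, 1] ->
  lebesgue_measure.-integrable [set` i] (EFin \o (fun=> c)).
Proof.
move=> s; apply: (@integrableS _ _ _ lebesgue_measure I _ _ mI (measurable_itv i) s).
apply: (@continuous_compact_integrable R (fun=> c) I); first exact: segment_compact.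
by apply: continuous_subspaceT => y; exact: cvg_cst.
Qed.

Let x_int (i : interval R) : [set` i] `<=` `[0, 1] ->
  lebesgue_measure.-integrable [set` i] (EFin \o x).
Proof.
move=> s; apply: (@integrableS _ _ _ lebesgue_measure I _ _ mI (measurable_itv i) s).
apply: (le_integrable_EFin _ x_meas _ (cst_int 1 (fun=> id))) => // t.
by rewrite /I/= in_itv/= => /x01 /andP[x0 x1]; rewrite !ger0_norm.
Qed.

Lemma rent0 : rent 0 = 0.
Proof. by rewrite /rent set_itv1 Rintegral_set1. Qed.

(** Monotonicity bounds the integrand by its end values. These are the incentive constraints: [x] is
    a subgradient of the convex function [rent x]. *)
Lemma rent_slope (s t : R) : 0 <= s -> s <= t -> t <= 1 ->
  x s * (t - s) <= rent t - rent s <= x t * (t - s).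
Proof.
move=> s0 st t1.
rewrite /rent (@Rintegral_itvB _ _ (BLeft 0) (BRight t) s)//; last first.
  by apply: x_int; apply: subset_itvl; rewrite bnd_simp.
have sub : `]s, t] `<=` (`[0, 1] : set R).
  by move=> y /=; rewrite !in_itv/=; lra.
have c (k : R) : k * (t - s) = \int[lebesgue_measure]_(y in `]s, t]) k.
  rewrite Rintegral_cst//= lebesgue_measure_itv/= lte_fin.
  by move: st; rewrite le_eqVlt => /orP[/eqP ->|->//]; rewrite ltxx subrr.
rewrite !c; apply/andP; split.
  apply: le_Rintegral => //; [exact: cst_int|exact: x_int|].
  by move=> y /=; rewrite in_itv/= => yst; apply: x_nd; lra.
apply: le_Rintegral => //; [exact: x_int|exact: cst_int|].
by move=> y /=; rewrite in_itv/= => yst; apply: x_nd; lra.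
Qed.

Lemma rent_ge0 (t : R) : 0 <= t <= 1 -> 0 <= rent t.
Proof.
move=> t01; apply: Rintegral_ge0 => s /=; rewrite in_itv/= => st.
by have /andP[] : 0 <= x s <= 1 by apply: x01; lra.
Qed.

Let f_meas : measurable_fun I f.
Proof. by apply: measurable_integrable; exact: density_integrable. Qed.

(** Both sides are the integral of [f t * x s] over the triangle [s <= t]; integrating over [t]
    first leaves the mass [1 - F] of the types above [s]. *)
Lemma rent_tonelli :
  (\int[lebesgue_measure]_(t in I) (rent t * f t)%:E =
   \int[lebesgue_measure]_(s in I) (x s * (1 - cdf_of f s))%:E)%E.
Proof.
pose A : set (R * R) := [set z | z.2 <= z.1].
pose K (z : R * R) : \bar R := ((f \_ I) z.1 * ((x \_ I) z.2 * \1_A z))%:E.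
have mfI : measurable_fun setT (f \_ I) by apply/(measurable_restrictT _ mI).
have mxI : measurable_fun setT (x \_ I) by apply/(measurable_restrictT _ mI).
have mA : measurable A.
  have -> : A = (fun z => z.1 - z.2) @^-1` `[0, +oo[%classic.
    by apply/seteqP; split=> z; rewrite /A /= in_itv/= andbT subr_ge0.
  rewrite -[X in measurable X]setTI.
  have /(_ measurableT) : measurable_fun setT (fun z : R * R => z.1 - z.2).
    by apply: measurable_funB; [exact: measurable_fst|exact: measurable_snd].
  by apply.
have fI0 t : 0 <= (f \_ I) t.
  by rewrite patchE; case: ifPn => //; rewrite inE /I/= in_itv/= => /f_gt0/ltW.
have xI0 t : 0 <= (x \_ I) t.
  by rewrite patchE; case: ifPn => //; rewrite inE /I/= in_itv/= => /x01/andP[].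
have mK : measurable_fun setT K.
  apply/measurable_EFinP; apply: measurable_funM.
    by apply: measurableT_comp => //; exact: measurable_fst.
  apply: measurable_funM; last exact: measurable_indic.
  by apply: measurableT_comp => //; exact: measurable_snd.
have K0 z : (0 <= K z)%E.
  by rewrite /K lee_fin mulr_ge0// mulr_ge0// indicE.
have patch0 (h : R -> R) (i : interval R) (s : R) :
    ((h \_ [set` i]) s)%:E = ((EFin \o h) \_ [set` i]) s.
  by rewrite !patchE; case: ifP.
have := @fubini_tonelli _ _ _ _ R lebesgue_measure lebesgue_measure K mK K0.
rewrite [X in X = _](_ : _ = (\int[lebesgue_measure]_(t in I) (rent t * f t)%:E)%E); last first.
  rewrite [RHS]integral_mkcond; apply: eq_integral => t _.
  under eq_integral do rewrite /K EFinM /=.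
  rewrite ge0_integralZl_EFin//; last 2 first.
  - by move=> s _; rewrite lee_fin mulr_ge0// indicE.
  - apply/measurable_EFinP/measurable_funM => //.
    apply: (measurable_funS measurableT) => //.
    have -> : (fun s => \1_A (t, s)) = \1_(`]-oo, t]%classic : set R) :> (R -> R).
      by apply/funext => s; rewrite !indicE; congr (_%:R); apply/idP/idP; rewrite !inE /A/= in_itv.
    exact: measurable_indic.
  rewrite patchE; case: ifPn => tI; last by rewrite patchE (negbTE tI) mul0e.
  rewrite patchE tI; move: tI; rewrite inE /I/= in_itv/= => t01.
  rewrite mulrC EFinM; congr (_ * _)%E.
  rewrite /rent /Rintegral fineK; last first.
    apply: integrable_fin_num => //; apply: x_int.
    by apply: subset_itvl; rewrite bnd_simp; lra.
  rewrite [RHS]integral_mkcond; apply: eq_integral => s _.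
  rewrite -[RHS]patch0; congr EFin; rewrite !patchE indicE.
  have -> : ((t, s) \in A) = (s <= t) by apply/idP/idP; rewrite inE.
  rewrite /I !mem_setE/= !in_itv/=.
  case: (leP 0 s) => s0 /=; last by rewrite mul0r.
  by case: (leP s t) => st; case: (leP s 1) => s1; rewrite ?mulr1 ?mulr0 ?mul0r//; lra.
rewrite [X in _ = X -> _](_ : _ =
  (\int[lebesgue_measure]_(s in I) (x s * (1 - cdf_of f s))%:E)%E)//.
rewrite [RHS]integral_mkcond; apply: eq_integral => s _.
under eq_integral do rewrite /K mulrCA EFinM /=.
rewrite ge0_integralZl_EFin//; last 2 first.
- by move=> t _; rewrite lee_fin mulr_ge0// indicE.
- apply/measurable_EFinP/measurable_funM => //.
  apply: (measurable_funS measurableT) => //.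
  have -> : (fun t => \1_A (t, s)) = \1_(`[s, +oo[%classic : set R) :> (R -> R).
    apply/funext => t; rewrite !indicE.
    have -> // : ((t, s) \in A) = (t \in (`[s, +oo[%classic : set R)).
    by apply/idP/idP; rewrite !inE /A/= in_itv/= andbT.
  exact: measurable_indic.
rewrite patchE; case: ifPn => sI; last by rewrite patchE (negbTE sI) mul0e.
rewrite patchE sI; move: sI; rewrite inE /I/= in_itv/= => s01.
rewrite EFinM; congr (_ * _)%E.
have [fi fs0 fs1] : [/\ lebesgue_measure.-integrable `]s, 1] (EFin \o f), 0 <= s & s <= 1].
  split; [|lra|lra].
  apply: (@integrableS _ _ _ lebesgue_measure I _ _ mI (measurable_itv _)).
    by move=> y; rewrite /I/= !in_itv/=; lra.
  exact: density_integrable.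
have -> : 1 - cdf_of f s = \int[lebesgue_measure]_(y in `]s, 1]) f y.
  by rewrite cdf_diff// f_density.
rewrite /Rintegral fineK; last exact: integrable_fin_num.
(* The section of the triangle contains the point [s], which []s, 1]] omits; a single point is
   negligible. *)
rewrite integral_itv_obnd_cbnd; last exact: (measurable_int lebesgue_measure).
rewrite [RHS]integral_mkcond; apply: eq_integral => t _.
rewrite -[RHS]patch0; congr EFin; rewrite !patchE indicE.
have -> : ((t, s) \in A) = (s <= t) by apply/idP/idP; rewrite inE.
rewrite /I !mem_setE/= !in_itv/=.
case: (leP t 1) => t1; rewrite ?andbT ?andbF/= ?mul0r//.
by case: (leP s t) => st; case: (leP 0 t) => t0'; rewrite ?mulr1 ?mulr0 ?mul0r//; lra.
Qed.

End information_rent.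

(** * Strategies and allocations *)

Section mechanism.
Context (R : realType) (f v : R -> R) (w : R -> \bar R).
Context (f_cont : {within `[0, 1], continuous f}).
Context (f_gt0 : forall t : R, 0 <= t <= 1 -> 0 < f t).
Context (f_density : cdf_of f 1 = 1).
Context (v_C1 : C1_on 0 1 v).
Context (v_decr : forall x y : R, 0 <= x -> x < y -> y <= 1 -> v y < v x).
Context (v0 : v 0 = 1) (v1 : v 1 = 0).
Context (w_C1 : C1_capacity w).
Context (w_ge0 : forall x : R, 0 <= x <= 1 -> (0 <= w x)%E).
Context (w_decr : forall x y : R, 0 <= x -> x <= y -> y <= 1 -> (w y <= w x)%E).
Context (w1 : w 1 = 0%E).

Notation phi := (capacity_of_value v w).
Notation g := (marginal_revenue f).
Notation fin := (w 0 \is a fin_num).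
Notation I := (`[0%R, 1%R]%classic : set R).
Notation D := (`[0%R, 1%R[%classic : set R).

Let mI : measurable I. Proof. exact: measurable_itv. Qed.
Let mD : measurable D. Proof. exact: measurable_itv. Qed.
Let sDI : D `<=` I.
Proof. by move=> t /=; rewrite !in_itv/=; lra. Qed.

(** Payment is value minus rent. The mean rent is the integral of [x * (1 - F)] by [rent_tonelli],
    and [t * f - (1 - F)] is [g]. *)
Lemma revenue_yield (x p q : R -> R) :
  (forall s t : R, 0 <= s -> s <= t -> t <= 1 -> x s <= x t) ->
  (forall t : R, 0 <= t <= 1 -> 0 <= x t <= 1) ->
  (forall t : R, 0 <= t <= 1 -> p (q t) = t * x t - rent x t) ->
  revenue f p q = (yield g x)%:E.
Proof.
move=> x_nd x01 pq; have fi := density_integrable f_cont.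
have rent_le (t : R) : 0 <= t <= 1 -> 0 <= rent x t <= 1.
  move=> t01; rewrite rent_ge0//=; have /andP[t0 t1] := t01.
  have /andP[_] := rent_slope x_nd x01 (lexx 0) t0 t1.
  by have := x01 t t01; rewrite rent0; nra.
have rent_nd (s t : R) : 0 <= s -> s <= t -> t <= 1 -> rent x s <= rent x t.
  move=> s0 st t1; have /andP[+ _] := rent_slope x_nd x01 s0 st t1.
  by have := x01 s; nra.
have mm (h : R -> R) : (forall s t : R, 0 <= s -> s <= t -> t <= 1 -> h s <= h t) ->
    measurable_fun I h.
  move=> hnd; apply: measurable_fun_ndecr_itv => s t; rewrite !in_itv/= => s01 t01 st.
  by apply: hnd; lra.
have bounded (h : R -> R) : measurable_fun I h ->
    (forall t, 0 <= t <= 1 -> 0 <= h t <= 1) ->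
    lebesgue_measure.-integrable I (EFin \o (fun t => h t * f t)).
  move=> mh h01; apply: (le_integrable_EFin _ _ _ fi) => //.
    by apply: measurable_funM => //; exact: measurable_integrable fi.
  move=> t /=; rewrite in_itv/= => /h01 /andP[h0 h1].
  by rewrite normrM ger0_norm// ler_piMl.
have i1 : lebesgue_measure.-integrable I (EFin \o (fun t => (t * x t) * f t)).
  apply: bounded; last by move=> t t01; have := x01 t t01; nra.
  apply: mm => s t s0 st t1; have := x_nd s t s0 st t1.
  have : 0 <= x s <= 1 by apply: x01; lra.
  nra.
have i2 : lebesgue_measure.-integrable I (EFin \o (fun t => rent x t * f t)).
  by apply: bounded => //; exact: mm.
have ig := marginal_revenue_integrable f_cont.
have i3 : lebesgue_measure.-integrable I (EFin \o (fun t => x t * g t)).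
  apply: (le_integrable_EFin _ _ _ ig) => //.
    apply: measurable_funM; first exact: mm.
    exact: measurable_integrable ig.
  move=> t /=; rewrite in_itv/= => /x01 /andP[x0 x1].
  by rewrite normrM ger0_norm// ler_piMl.
have [i4 e4] := integrable_Rintegral_lin 1 (-1) mI i1 i3.
have [i5 e5] := integrable_Rintegral_lin 1 (-1) mI i1 i2.
rewrite /revenue.
have -> : (\int[lebesgue_measure]_(t in I) (p (q t) * f t)%:E =
   (\int[lebesgue_measure]_(t in I) (1 * (t * x t * f t) + -1 * (rent x t * f t)))%:E)%E.
  rewrite /Rintegral fineK; last exact: integrable_fin_num.
  apply: eq_integral => t; rewrite inE/= in_itv/= => t01.
  by congr EFin; rewrite pq//; ring.
congr EFin; rewrite e5.
have -> : \int[lebesgue_measure]_(t in I) (rent x t * f t) =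
    \int[lebesgue_measure]_(t in I) (1 * (t * x t * f t) + -1 * (x t * g t)).
  rewrite {1}/Rintegral rent_tonelli//; congr fine; apply: eq_integral => t _.
  by congr EFin; rewrite /marginal_revenue; ring.
rewrite e4 /yield Rintegral_itv_bndo_bndc; first by ring.
exact: (@integrableS _ _ _ lebesgue_measure I _ _ mI mD sDI).
Qed.

Lemma user_choice_quality (Q : set R) (p q : R -> R) (t : R) :
  strategy Q p -> user_choice v Q p q -> 0 <= t <= 1 -> 0 <= q t <= 1.
Proof.
move=> [QI _ _] uc t01; have [Qq _] := uc t t01; case: Qq => [/QI|->]; last by rewrite lexx ler01.
by rewrite /= in_itv.
Qed.

(** Adding the incentive constraints of [s] and [t] cancels the prices and leaves a nonnegative
    product of increments. *)
Lemma user_choice_value (Q : set R) (p q : R -> R) :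
  strategy Q p -> user_choice v Q p q ->
  (forall s t : R, 0 <= s -> s <= t -> t <= 1 -> v (q s) <= v (q t)).
Proof.
move=> S uc s t s0; rewrite le_eqVlt => /orP[/eqP->//|st] t1.
have s01 : 0 <= s <= 1 by lra.
have t01 : 0 <= t <= 1 by lra.
have [qs /(_ (q t))] := uc s s01; have [qt /(_ (q s) qs)] := uc t t01.
move=> + /(_ qt); nra.
Qed.

Lemma user_choice_value01 (Q : set R) (p q : R -> R) (t : R) :
  strategy Q p -> user_choice v Q p q -> 0 <= t <= 1 -> 0 <= v (q t) <= 1.
Proof.
move=> S uc t01; apply: (v_01 v_decr v0 v1).
exact: (user_choice_quality S uc).
Qed.

(** Incentive constraints enclose the increments of utility between the same bounds as those of the
    rent, so their difference [d] is constant. It is 0 at type 0, who pays nothing because the dummy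
    class is free and prices are nonnegative. *)
Lemma user_choice_price (Q : set R) (p q : R -> R) (t : R) :
  strategy Q p -> user_choice v Q p q -> 0 <= t <= 1 ->
  p (q t) = t * v (q t) - rent (v \o q) t.
Proof.
move=> S uc t01; have x_nd := user_choice_value S uc.
have x01 := fun t => @user_choice_value01 _ _ _ t S uc.
have [_ p0 p1] := S.
pose d (s : R) := (s * v (q s) - p (q s)) - rent (v \o q) s.
have t0 : 0 <= t by lra.
have := @constant_of_monotone_slope R d (v \o q) 0 t t0.
have -> : d 0 = 0.
  have z01 : (0 : R) <= 0 <= (1 : R) by lra.
  rewrite /d rent0 mul0r subr0 sub0r.
  have [Qq q_opt] := uc 0 z01.
  have := q_opt 1 (or_intror erefl); rewrite v1 p1 mul0r subr0 mul0r sub0r => H.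
  have : 0 <= p (q 0) by case: Qq => [/p0//|->]; rewrite p1.
  lra.
rewrite /d => H; suff : t * v (q t) - p (q t) - rent (v \o q) t = 0 by lra.
apply: H => a b a0 ab bt.
have b1 : b <= 1 by lra.
have /andP[] := @rent_slope R (v \o q) x_nd x01 a b a0 ab b1.
have a01 : 0 <= a <= 1 by lra.
have b01 : 0 <= b <= 1 by lra.
have [qa /(_ (q b))] := uc a a01; have [qb /(_ (q a) qa)] := uc b b01.
move=> + /(_ qb) /=; rewrite ler_norml; nra.
Qed.

Lemma user_choice_revenue (Q : set R) (p q : R -> R) :
  strategy Q p -> user_choice v Q p q ->
  revenue f p q = (yield g (v \o q))%:E.
Proof.
move=> S uc; apply: revenue_yield.
- exact: (user_choice_value S uc).
- by move=> t; exact: (user_choice_value01 S uc).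
- by move=> t; exact: (user_choice_price S uc).
Qed.

Let emeasurable_fun_ndecr (h : R -> \bar R) :
  (forall s t : R, 0 <= s -> s <= t -> t <= 1 -> (h s <= h t)%E) ->
  measurable_fun I h.
Proof.
move=> h_nd.
apply: (measurability (@ErealGenCInfty.G R)) => //.
  exact: ErealGenCInfty.measurableE.
move=> /= _ [_] [r ->] <-.
apply: is_interval_measurable => s t/= [+ +] [+ _] u /andP[su ut].
rewrite !in_itv/= andbT => s01 fs t01; split; first by move: su ut s01 t01; rewrite /=; lra.
by rewrite (le_trans fs)// h_nd//; lra.
Qed.

(** * Capacity used by a user choice *)

Section capacity.
Context (q : R -> R).
Context (q01 : forall t : R, 0 <= t <= 1 -> 0 <= q t <= 1).
Context (q_nd : forall s t : R, 0 <= s -> s <= t -> t <= 1 -> v (q s) <= v (q t)).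

Let q_ni (s t : R) : 0 <= s -> s <= t -> t <= 1 -> q t <= q s.
Proof.
move=> s0 st t1; rewrite leNgt; apply/negP => qst.
have qs := q01 (_ : 0 <= s <= 1); have qt := q01 (_ : 0 <= t <= 1).
have : v (q t) < v (q s).
  by apply: v_decr => //; [have := qs|have := qt]; lra.
by rewrite ltNge q_nd.
Qed.

Let wqf_meas : measurable_fun I (fun t => w (q t) * (f t)%:E)%E.
Proof.
apply: emeasurable_funM.
  apply: emeasurable_fun_ndecr => s t s0 st t1.
  apply: w_decr; last 1 first.
  - by have /andP[] : 0 <= q s <= 1 by apply: q01; lra.
  - by have /andP[] : 0 <= q t <= 1 by apply: q01; lra.
  - exact: q_ni.
by apply/measurable_EFinP; apply: measurable_integrable; exact: density_integrable.
Qed.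

Let wqf_ge0 (t : R) : I t -> (0 <= w (q t) * (f t)%:E)%E.
Proof.
rewrite /= in_itv/= => t01; apply: mule_ge0; first exact/w_ge0/q01.
by rewrite lee_fin ltW// f_gt0.
Qed.

Lemma capacity_used_load :
  (forall t : R, 0 <= t < 1 -> v (q t) < 1 \/ fin) ->
  capacity_used f w q =
    (\int[lebesgue_measure]_(t in D) (phi (v (q t)) * f t)%:E)%E.
Proof.
move=> qf; rewrite /capacity_used -integral_itv_bndo_bndc; last first.
  exact: measurable_funS wqf_meas.
apply: eq_integral => t; rewrite inE/= in_itv/= => t01.
have qt : 0 <= q t <= 1 by apply: q01; lra.
rewrite EFinM -(w_quality v_C1 v0 v1 w_C1); last first.
  by split; [exact: (v_01 v_decr v0 v1)|exact: qf].
by rewrite (quality_v v_C1 v_decr v0 v1).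
Qed.

(** When [w 0] is infinite, a type below 1 choosing quality 0 would be followed by all higher types,
    an interval of positive length, and the capacity used would be infinite. *)
Lemma allocation_of_capacity (C : R) : (capacity_used f w q <= C%:E)%E ->
  allocation f phi fin (v \o q) /\ load f phi (v \o q) <= C.
Proof.
move=> qC.
have qf (t : R) : 0 <= t < 1 -> v (q t) < 1 \/ fin.
  move=> t01; have [|finN] := boolP fin; [by right|left].
  have qt : 0 <= q t <= 1 by apply: q01; lra.
  have /andP[_ vq1] := v_01 v_decr v0 v1 qt.
  rewrite lt_neqAle vq1 andbT; apply/eqP => vq.
  suff : (+oo <= capacity_used f w q)%E by move=> /le_trans/(_ qC); rewrite leye_eq.
  have z01 : 0 <= (0 : R) <= 1 by lra.
  have w0 : w 0 = +oo%E.
    by have := w_ge0 z01; move: finN; case: (w 0).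
  apply: (@le_trans _ _ (integral lebesgue_measure (`[t, 1]%classic : set R)
    (fun s => w (q s) * (f s)%:E)%E)); last first.
    apply: ge0_subset_integral => //.
    by move=> s /=; rewrite !in_itv/=; lra.
  rewrite (eq_integral (cst +oo%E)).
    rewrite integral_cst//= lebesgue_measure_itv/= lte_fin.
    have -> : t < 1 by lra.
    by rewrite -EFinB mulyr gtr0_sg ?subr_gt0 ?mul1e//; lra.
  move=> s; rewrite inE/= in_itv/= => st.
  have qs : 0 <= q s <= 1 by apply: q01; lra.
  have -> : q s = 0.
    apply: (v_inj v_decr) => //; rewrite v0; apply/eqP; rewrite eq_le.
    have /andP[_ ->] := v_01 v_decr v0 v1 qs.
    by rewrite -vq q_nd//; lra.
  by rewrite w0 mulyr gtr0_sg ?mul1e// f_gt0//; lra.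
have qE := capacity_used_load qf.
have sq (t : R) : 0 <= t < 1 -> served fin (v (q t)).
  move=> t01; split; last exact: qf.
  by apply: (v_01 v_decr v0 v1); apply: q01; lra.
have pf0 (t : R) : D t -> 0 <= phi (v (q t)) * f t.
  rewrite /= in_itv/= => t01; rewrite mulr_ge0//; last by apply/ltW/f_gt0; lra.
  rewrite -(capacity_of_value0 v_C1 v_decr v0 v1 w1).
  apply: (capacity_of_value_homo v_C1 v_decr v0 v1 w_C1 w_decr) => //; last exact: sq.
  by have [/andP[]] := sq t t01.
have ip : lebesgue_measure.-integrable D (EFin \o (fun t => phi (v (q t)) * f t)).
  apply/integrableP; split.
    have mw : measurable_fun D (fun t => w (q t) * (f t)%:E)%E.
      exact: measurable_funS wqf_meas.
    apply: eq_measurable_fun mw => t; rewrite inE/= in_itv/= => t01.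
    have qt : 0 <= q t <= 1 by apply: q01; lra.
    rewrite EFinM -(w_quality v_C1 v0 v1 w_C1); last exact: sq.
    by rewrite (quality_v v_C1 v_decr v0 v1).
  apply: le_lt_trans (ltry C); rewrite (le_trans _ qC)// qE.
  rewrite le_eqVlt; apply/orP; left; apply/eqP.
  by apply: eq_integral => t; rewrite inE => Dt; rewrite gee0_abs// lee_fin; exact: pf0.
split.
  split => //; first by move=> t t01; apply: (v_01 v_decr v0 v1); exact: q01.
rewrite -lee_fin /load /Rintegral fineK; last exact: integrable_fin_num.
by rewrite -qE.
Qed.

End capacity.

(* The price of a quality is the convex conjugate of the rent, which extends the
   incentive-compatible payment [t * y t - rent y t] to all qualities. *)
Definition conjugate_price (y : R -> R) (z : R) : R :=
  sup [set t * v z - rent y t | t in I].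

(** By [rent_slope] the supremum pricing [q s] is attained at type [s], and the one pricing the
    dummy class at type 0, where it is 0. The same inequalities make [q t] the best choice of type
    [t]. *)
Lemma strategy_of_allocation (C : R) (y : R -> R) :
  allocation f phi fin y -> load f phi y <= C ->
  exists Q p q, feasible f v w C Q p q /\ revenue f p q = (yield g y)%:E.
Proof.
move=> [y_nd y01 yf yi] yC.
pose q t := quality v (y t).
have vq (t : R) : 0 <= t <= 1 -> v (q t) = y t.
  by move=> t01; have [] := qualityP v_C1 v0 v1 (y01 t t01).
have q01 (t : R) : 0 <= t <= 1 -> 0 <= q t <= 1.
  by move=> t01; have [] := qualityP v_C1 v0 v1 (y01 t t01).
have supE z (s : R) : 0 <= s <= 1 ->
    (forall t : R, 0 <= t <= 1 -> t * v z - rent y t <= s * v z - rent y s) ->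
    conjugate_price y z = s * v z - rent y s.
  move=> s01 smax; apply/eqP; rewrite eq_le; apply/andP; split.
    apply: ge_sup; first by exists (s * v z - rent y s), s => //=; rewrite in_itv.
    by move=> _ [t /= + <-]; rewrite in_itv/= => /smax.
  apply: sup_ubound; last by exists s => //=; rewrite in_itv.
  exists (s * v z - rent y s) => _ [t /= + <-]; rewrite in_itv/= => /smax//.
have pq (s : R) : 0 <= s <= 1 -> conjugate_price y (q s) = s * y s - rent y s.
  move=> s01; rewrite (supE _ s)// ?vq// => t t01.
  have [ts|st] := leP t s.
    have [t0 s1] : 0 <= t /\ s <= 1 by lra.
    by have /andP[_] := rent_slope y_nd y01 t0 ts s1; nra.
  have [s0 t1] : 0 <= s /\ t <= 1 by lra.
  by have /andP[+ _] := rent_slope y_nd y01 s0 (ltW st) t1; nra.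
have z01 : 0 <= (0 : R) <= 1 by lra.
have rent_y0 := @rent_ge0 R y y01.
have p1 : conjugate_price y 1 = 0.
  rewrite (supE _ 0)// ?v1 ?rent0 ?mul0r ?subr0// => t t01.
  by have := rent_y0 t t01; rewrite mulr0; lra.
have p_ge0 (s : R) : 0 <= s <= 1 -> 0 <= conjugate_price y (q s).
  move=> s01; rewrite pq//; have /andP[s0 s1] := s01.
  by have /andP[_] := rent_slope y_nd y01 (lexx 0) s0 s1; rewrite rent0; nra.
exists [set q t | t in I], (conjugate_price y), q; split; last first.
  by apply: revenue_yield.
split.
- split => //.
    by move=> _ [t /= + <-]; rewrite !in_itv/=; exact: q01.
  by move=> _ [t /= + <-]; rewrite !in_itv/=; exact: p_ge0.
- move=> t t01; split; first by left; exists t => //=; rewrite in_itv.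
  rewrite vq// pq//.
  move=> z [[s /= + <-]|->]; last first.
    by rewrite p1 v1 mulr0 subr0; have := rent_y0 t t01; lra.
  rewrite in_itv/= => s01; rewrite vq// pq//.
  have [ts|st] := leP t s.
    have [t0 s1] : 0 <= t /\ s <= 1 by lra.
    by have /andP[_] := rent_slope y_nd y01 t0 ts s1; nra.
  have [s0 t1] : 0 <= s /\ t <= 1 by lra.
  by have /andP[+ _] := rent_slope y_nd y01 s0 (ltW st) t1; nra.
- rewrite capacity_used_load//; last 2 first.
  + move=> s t s0 st t1; rewrite !vq; [exact: y_nd|lra|lra].
  + by move=> t t01; rewrite vq; [exact: yf|lra].
  rewrite -lee_fin /load /Rintegral fineK in yC; last exact: integrable_fin_num.
  apply: le_trans yC; rewrite le_eqVlt; apply/orP; left; apply/eqP.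
  apply: eq_integral => t; rewrite inE/= in_itv/= => t01.
  by rewrite vq//; lra.
Qed.

Lemma optimal_allocation_of_strategy (C : R) (Q : set R) (p q : R -> R) :
  optimal_strategy f v w C Q p q ->
  optimal_allocation f g phi fin C (v \o q).
Proof.
move=> [[S uc qC] q_opt].
have [xA xC] := allocation_of_capacity
  (fun t => user_choice_quality S uc) (user_choice_value S uc) qC.
split => // y yA yC; have [Q' [p' [q' [feas revE]]]] := strategy_of_allocation yA yC.
have := q_opt _ _ _ feas.
by rewrite revE (user_choice_revenue S uc) lee_fin.
Qed.

Lemma capacity_used_ge0 (C : R) (Q : set R) (p q : R -> R) :
  feasible f v w C Q p q -> 0 <= C.
Proof.
move=> [S uc qC]; rewrite -lee_fin; apply: le_trans qC.
apply: integral_ge0 => t /=; rewrite in_itv/= => t01.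
apply: mule_ge0; first by apply: w_ge0; exact: (user_choice_quality S uc).
by rewrite lee_fin ltW// f_gt0.
Qed.

End mechanism.

(** * The range of qualities *)

Lemma cvg_at_right_lt (R : realType) (q : R -> R) (m l c : R) :
  q t @[t --> m^'+] --> l -> l < c ->
  exists2 e, 0 < e & forall t, m < t < m + e -> q t < c.
Proof.
move=> /cvgr_lt ql lc; have := ql c lc.
rewrite near_withinE => -[e /= e0 eh]; exists e => // t mt.
by apply: eh => /=; [rewrite /ball_ /= ltr0_norm; lra|lra].
Qed.

Lemma cvg_at_right_gt (R : realType) (q : R -> R) (m l c : R) :
  q t @[t --> m^'+] --> l -> c < l ->
  exists2 e, 0 < e & forall t, m < t < m + e -> c < q t.
Proof.
move=> /cvgr_gt ql lc; have := ql c lc.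
rewrite near_withinE => -[e /= e0 eh]; exists e => // t mt.
by apply: eh => /=; [rewrite /ball_ /= ltr0_norm; lra|lra].
Qed.

Lemma cvg_at_left_lt (R : realType) (q : R -> R) (m l c : R) :
  q t @[t --> m^'-] --> l -> l < c ->
  exists2 e, 0 < e & forall t, m - e < t < m -> q t < c.
Proof.
move=> /cvgr_lt ql lc; have := ql c lc.
rewrite near_withinE => -[e /= e0 eh]; exists e => // t mt.
by apply: eh => /=; [rewrite /ball_ /= ger0_norm; lra|lra].
Qed.

Lemma marginal_user_01 (R : realType) (q : R -> R) : 0 <= marginal_user q <= 1.
Proof.
rewrite /marginal_user; set S := [set t | _].
(* If no type opts out, the supremum of the empty set is 0 by convention. *)
have [->|/set0P S0] := eqVneq S set0; first by rewrite sup0 lexx ler01.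
have ubS : ubound S 1 by move=> t [/andP[]].
rewrite ge_sup// andbT; have [t St] := S0; have [/andP[t0 _] _] := St.
by apply: le_trans t0 _; apply: sup_ubound => //; exists 1.
Qed.

Section range.
Context (R : realType) (f v : R -> R) (w : R -> \bar R) (t0 : R).
Context (f_cont : {within `[0, 1], continuous f}).
Context (f_gt0 : forall t : R, 0 <= t <= 1 -> 0 < f t).
Context (f_density : cdf_of f 1 = 1).
Context (v_C1 : C1_on 0 1 v).
Context (v_decr : forall x y : R, 0 <= x -> x < y -> y <= 1 -> v y < v x).
Context (v0 : v 0 = 1) (v1 : v 1 = 0).
Context (w_C1 : C1_capacity w).
Context (w_ge0 : forall x : R, 0 <= x <= 1 -> (0 <= w x)%E).
Context (w_decr : forall x y : R, 0 <= x -> x <= y -> y <= 1 -> (w y <= w x)%E).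
Context (w1 : w 1 = 0%E).
Context (t0_in : 0 < t0 < 1) (t0_zero : virtual_valuation f t0 = 0).
Context (t0_uniq : forall t : R, 0 < t < 1 -> virtual_valuation f t = 0 -> t = t0).
Context (h_decr : forall x y : R, 0 < x -> x < y -> y < 1 ->
     virtual_capacity v w y < virtual_capacity v w x).

Notation phi := (capacity_of_value v w).
Notation g := (marginal_revenue f).
Notation fin := (w 0 \is a fin_num).
Notation I := (`[0%R, 1%R]%classic : set R).
Notation D := (`[0%R, 1%R[%classic : set R).

Let integrable_ID (h : R -> R) : lebesgue_measure.-integrable I (EFin \o h) ->
  lebesgue_measure.-integrable D (EFin \o h).
Proof.
have mI : measurable I by exact: measurable_itv.
have mD : measurable D by exact: measurable_itv.
apply: (@integrableS _ _ _ lebesgue_measure I _ _ mI mD).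
by move=> t /=; rewrite !in_itv/=; lra.
Qed.

Let f_int := integrable_ID (density_integrable f_cont).
Let g_int := integrable_ID (marginal_revenue_integrable f_cont).
Let g_cont := marginal_revenue_continuous f_cont.
Let phi0 := capacity_of_value0 v_C1 v_decr v0 v1 w1.
Let phi_homo := capacity_of_value_homo v_C1 v_decr v0 v1 w_C1 w_decr.
Let phi_conv := capacity_of_value_convex v_C1 v_decr v0 v1 w_C1 w_decr h_decr.
Let g_lt0 := marginal_revenue_lt0 f_cont f_gt0 t0_in t0_uniq.
Let g_gt0 := marginal_revenue_gt0 f_cont f_gt0 f_density t0_in t0_uniq.
Let g_t0 := marginal_revenue_t0 f_gt0 t0_in t0_zero.
Let optimal_value := optimal_allocation_of_strategy f_cont f_gt0 f_density
  v_C1 v_decr v0 v1 w_C1 w_ge0 w_decr w1.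

(** Translates the capacity threshold into the load by which the allocation problem expresses
    scarcity. *)
Lemma load_single_class : fin ->
  (load f phi (single_class t0))%:E = saturating_capacity f w t0.
Proof.
move=> finT; have t01 := t0_in.
have [_ _ _ si] := single_class_allocation f_gt0 f_int phi0 phi_homo t0 finT.
have fi := density_integrable f_cont.
pose h t := phi (single_class t0 t) * f t.
have hi : lebesgue_measure.-integrable I (EFin \o h).
  have mI : measurable I by exact: measurable_itv.
  have ci : lebesgue_measure.-integrable I (EFin \o (fun t => phi 1 * f t)).
    exact: (@integrableZl _ _ _ lebesgue_measure I mI (phi 1) _ fi).
  apply: (le_integrable_EFin mI _ _ ci).
    apply: measurable_funM; last exact: measurable_integrable fi.
    apply: measurable_fun_ndecr_itv => s t; rewrite !in_itv/= => s01 t01' st.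
    rewrite /single_class; case: (leP s t0) => hs; case: (leP t t0) => ht //; last by lra.
    by apply: phi_homo => //; split; [lra|right].
  move=> t /= _; rewrite /h /single_class; case: ifP => _ //.
  by rewrite phi0 mul0r normr0.
rewrite /load -/(h _) (_ : \int[lebesgue_measure]_(t in D) _ = (1 - cdf_of f t0) * fine (w 0)).
  by rewrite EFinM fineK.
rewrite Rintegral_itv_bndo_bndc//.
have := @Rintegral_itvB _ h (BLeft 0) (BRight 1) t0 hi; rewrite !bnd_simp.
have t00 : 0 <= t0 by lra.
have t0le1 : t0 <= 1 by lra.
have -> : \int[lebesgue_measure]_(t in `[0, t0]) h t = 0.
  transitivity (\int[lebesgue_measure]_(t in (`[0, t0]%classic : set R)) (cst 0 t)).
    apply: eq_Rintegral => t; rewrite inE/= in_itv/= => /andP[_ tt].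
    by rewrite /h /single_class tt phi0 mul0r.
  by rewrite Rintegral_cst// mul0r.
move=> /(_ t00 t0le1); rewrite subr0 => ->.
have -> : 1 - cdf_of f t0 = \int[lebesgue_measure]_(y in `]t0, 1]) f y.
  by rewrite cdf_diff// f_density.
rewrite mulrC.
rewrite -RintegralZl//; last first.
  apply: (@integrableS _ _ _ lebesgue_measure I) => //.
  by move=> t /=; rewrite !in_itv/=; lra.
apply: eq_Rintegral => t; rewrite inE/= in_itv/= => /andP[tt _].
by rewrite /h /single_class leNgt tt/= (capacity_of_value1 w v_C1 v_decr v0 v1).
Qed.

(** The allocation is known at all types except [t0], which is therefore the marginal user;
    continuity from the right settles its choice. An infinite [w 0] is excluded because the
    threshold would be infinite. *)
Lemma saturated_range (C : R) (Q : set R) (p q : R -> R) :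
  (saturating_capacity f w t0 <= C%:E)%E ->
  optimal_strategy f v w C Q p q -> continuous_at_end_types q ->
  q 1 = 0 /\ q (marginal_user q) = 0.
Proof.
move=> satC q_opt [_ qm]; have t01 := t0_in.
have finT : fin.
  have w00 : (0 <= w 0)%E by apply: w_ge0; rewrite lexx ler01.
  move: satC w00; rewrite /saturating_capacity; case: (w 0) => //.
  have Ft0 : cdf_of f t0 < 1 by rewrite -f_density; apply: cdf_lt => //; lra.
  by rewrite mulry gtr0_sg ?subr_gt0// mul1e leye_eq.
rewrite -load_single_class// lee_fin in satC.
have [x0 x1] := saturated_allocation f_gt0 f_int g_int phi0 phi_homo t0_in
  g_lt0 g_t0 g_gt0 finT satC (optimal_value q_opt).
have [[S uc _] _] := q_opt.
have q01 (t : R) : 0 <= t <= 1 -> 0 <= q t <= 1 by exact: (user_choice_quality S uc).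
have q1 (t : R) : 0 <= t < t0 -> q t = 1.
  by move=> tt; apply: (v_inj v_decr); [apply: q01; lra|lra|rewrite v1; exact: x0].
have q0 (t : R) : t0 < t <= 1 -> q t = 0.
  by move=> tt; apply: (v_inj v_decr); [apply: q01; lra|lra|rewrite v0; exact: x1].
have ubM : ubound [set t | 0 <= t <= 1 /\ q t = 1] t0.
  move=> t [t1 qt]; rewrite leNgt; apply/negP => tt.
  by move: qt; rewrite q0; lra.
have mE : marginal_user q = t0.
  apply/eqP; rewrite eq_le; apply/andP; split.
    by apply: ge_sup => //; exists 0; split; [lra|apply: q1; lra].
  rewrite leNgt; apply/negP => mt.
  have m01 := marginal_user_01 q.
  have : (marginal_user q + t0) / 2 <= marginal_user q.
    by apply: sup_ubound; [exists t0|split; [lra|apply: q1; lra]].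
  lra.
split; first by apply: q0; lra.
rewrite mE; have /andP[qt0 _] : 0 <= q t0 <= 1 by apply: q01; lra.
apply/eqP; rewrite eq_le qt0 andbT leNgt; apply/negP => qt0'.
have t0lt1 : t0 < 1 by lra.
rewrite mE in qm; have [e e0 he] := cvg_at_right_gt (qm t0lt1) qt0'.
pose t := Num.min 1 (t0 + e / 2).
have tt : t0 < t < t0 + e.
  by rewrite /t lt_min gt_min; apply/andP; split; [apply/andP; split; lra|apply/orP; right; lra].
have := he t tt; rewrite q0 ?ltxx//; apply/andP; split; first by case/andP: tt.
by rewrite /t ge_min lexx.
Qed.

(** A marginal quality better than 1 would, by continuity from the right, make the value jump at the
    marginal type, against [no_jump]. *)
Lemma scarce_worst_quality (C : R) (Q : set R) (p q : R -> R) :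
  (C%:E < saturating_capacity f w t0)%E -> 0 < C ->
  optimal_strategy f v w C Q p q -> continuous_at_end_types q ->
  q (marginal_user q) = 1.
Proof.
move=> unsat C0 q_opt [ql qm]; have x_opt := optimal_value q_opt.
have [[S uc _] _] := q_opt.
have q01 (t : R) : 0 <= t <= 1 -> 0 <= q t <= 1 by exact: (user_choice_quality S uc).
have x_nd := user_choice_value S uc.
have [s s01 xs] := exists_excluded f_gt0 f_int g_int phi0 phi_homo phi_conv t0_in g_lt0 C0 x_opt.
have q1 (t : R) : 0 <= t <= 1 -> v (q t) <= 0 -> q t = 1.
  move=> t01 vt; apply: (v_inj v_decr); [exact: q01|lra|rewrite v1].
  by have /andP[] := user_choice_value01 v_decr v0 v1 S uc t01; lra.
set m := marginal_user q; have m01 : 0 <= m <= 1 by exact: marginal_user_01.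
have Ss : [set t | 0 <= t <= 1 /\ q t = 1] s.
  by split; [lra|apply: q1; [lra|rewrite [v _]xs]].
have hS : has_sup [set t | 0 <= t <= 1 /\ q t = 1].
  by split; [exists s|exists 1 => t [/andP[]]].
have sm : s <= m by apply: sup_ubound => //; case: hS.
have xm (t : R) : 0 <= t < m -> v (q t) = 0.
  move=> tm; have [t' [t'01 qt'] tt'] : exists2 t', [set t | 0 <= t <= 1 /\ q t = 1] t' & t < t'.
    by apply: sup_gt; [exists s|case/andP: tm].
  have : v (q t) <= v (q t') by apply: x_nd; lra.
  rewrite qt' v1.
  have t01 : 0 <= t <= 1 by lra.
  by have /andP[] := user_choice_value01 v_decr v0 v1 S uc t01; lra.
have qm01 := q01 _ m01.
apply/eqP; rewrite eq_le; case/andP: (qm01) => qm0 ->; rewrite leNgt/=; apply/negP => qm1.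
(* Qualities just above [m] stay below this midpoint, so [v c] bounds the height of the jump from
   below. *)
pose c := (q m + 1) / 2.
have cI : 0 < c < 1 by rewrite /c; lra.
have qc : q m < c by rewrite /c; lra.
(* If the marginal user is type 1, all lower types opt out and continuity from the left contradicts
   [q 1 < 1]. *)
have [mE|m1] := eqVneq m 1.
  rewrite mE in qc; have [e e0 he] := cvg_at_left_lt ql qc.
  pose t := Num.max 0 (1 - e / 2).
  have tt : 1 - e < t < 1.
    by rewrite /t gt_max lt_max; apply/andP; split; [apply/orP; right; lra|apply/andP; split; lra].
  have t0' : 0 <= t by rewrite /t le_max lexx.
  have := he t tt; rewrite q1; [lra|lra|rewrite xm// mE; lra].
have {}m1 : m < 1 by rewrite lt_neqAle m1; case/andP: m01.
have [e e0 he] := cvg_at_right_lt (qm m1) qc.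
have va : 0 < v c < 1.
  have : v 1 < v c by apply: v_decr; lra.
  have : v c < v 0 by apply: v_decr; lra.
  by rewrite v0 v1; lra.
have near_m (t : R) : m < t < m + e -> t <= 1 -> v c < v (q t).
  move=> tm t1; have := he t tm => qt.
  have /andP[qt0 _] : 0 <= q t <= 1 by apply: q01; lra.
  by apply: v_decr => //; lra.
apply: (no_jump f_gt0 f_int g_int phi0 phi_homo phi_conv f_cont g_cont t0_in
  g_t0 g_gt0 _ C0 x_opt _ va xm); last first.
- move=> t /andP[mt t1]; rewrite /=.
  have [<-|mt'] := eqVneq m t; first by apply: v_decr => //; lra.
  have {}mt : m < t by rewrite lt_neqAle mt'.
  pose t' := Num.min t (m + e / 2).
  have t'm : m < t' < m + e.
    by rewrite /t' lt_min mt gt_min; apply/andP; split; [lra|apply/orP; right; lra].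
  have t't : t' <= t by rewrite /t' ge_min lexx.
  apply: (lt_le_trans (near_m t' t'm _)); first by lra.
  by apply: x_nd; lra.
- by lra.
- by move=> finT; rewrite -lte_fin load_single_class.
Qed.

Lemma best_quality_mono (C1 C2 : R) (Q1 Q2 : set R) (p1 q1 p2 q2 : R -> R) :
  C1 < C2 ->
  optimal_strategy f v w C1 Q1 p1 q1 -> continuous_at_end_types q1 ->
  optimal_strategy f v w C2 Q2 p2 q2 -> q2 1 <= q1 1.
Proof.
move=> C12 q1_opt [ql _] q2_opt; rewrite leNgt; apply/negP => q12.
have [F1 _] := q1_opt; have C10 := capacity_used_ge0 f_gt0 w_ge0 F1.
have [S1 uc1 _] := F1; have [[S2 uc2 _] _] := q2_opt.
have i1 : 0 <= (1 : R) <= 1 by lra.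
have q11 := user_choice_quality S1 uc1 i1.
have q21 := user_choice_quality S2 uc2 i1.
(* Two intermediate qualities, so that [v c2 < v c1] span a chord separating the value [v (q2 1)]
   from the values of [q1] at types near 1. *)
pose c1 := (2 * q1 1 + q2 1) / 3; pose c2 := (q1 1 + 2 * q2 1) / 3.
have c12 : c1 < c2 by rewrite /c1 /c2; lra.
have c10 : 0 < c1 by rewrite /c1; lra.
have c21 : c2 < q2 1 by rewrite /c2; lra.
have qc1 : q1 1 < c1 by rewrite /c1; lra.
have [e e0 he] := cvg_at_left_lt ql qc1.
apply: (@top_quality_mono R f g phi fin f_gt0 f_int g_int phi0 phi_homo phi_conv
  f_cont g_cont (marginal_revenue_lt f_cont f_gt0 f_density)
  (marginal_revenue1 f_density) C1 C2 (v \o q1) (v \o q2) (Num.max 0 (1 - e)) (v c2) (v c1)) => //.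
- exact: optimal_value q1_opt.
- exact: optimal_value q2_opt.
- by have : v 1 < v c2; [apply: v_decr; lra|rewrite v1; lra].
- by apply: v_decr; lra.
- by have : v c1 < v 0; [apply: v_decr; lra|rewrite v0; lra].
- by apply: v_decr; lra.
- by rewrite le_max lexx.
- by rewrite gt_max ltr01; lra.
- move=> t; rewrite gt_max => /andP[/andP[t0' te] t1] /=.
  have t01 : 0 <= t <= 1 by lra.
  have te' : 1 - e < t < 1 by lra.
  have := user_choice_quality S1 uc1 t01; have := he t te' => h1 h2.
  by apply: v_decr; lra.
Qed.

End range.

Theorem corollary5 (R : realType) (f v : R -> R) (w : R -> \bar R)
  (t0 C1 C2 : R) (Q1 Q2 : set R)
  (f_C1 : C1_on 0 1 f)
  (f_gt0 : forall t, 0 <= t <= 1 -> 0 < f t)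
  (f_density : cdf_of f 1 = 1)
  (v_C1 : C1_on 0 1 v)
  (v_decr : forall x y, 0 <= x -> x < y -> y <= 1 -> v y < v x)
  (v0 : v 0 = 1)
  (v1 : v 1 = 0)
  (w_C1 : C1_capacity w)
  (w_ge0 : forall x, 0 <= x <= 1 -> (0 <= w x)%E)
  (w_decr : forall x y, 0 <= x -> x <= y -> y <= 1 -> (w y <= w x)%E)
  (w1 : w 1 = 0%E)
  (t0_in : 0 < t0 < 1)
  (t0_zero : virtual_valuation f t0 = 0)
  (t0_uniq : forall t, 0 < t < 1 -> virtual_valuation f t = 0 -> t = t0)
  (G_incr : forall s t, t0 < s -> s < t -> t < 1 ->
     virtual_valuation f s < virtual_valuation f t)
  (h_decr : forall x y, 0 < x -> x < y -> y < 1 ->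
     virtual_capacity v w y < virtual_capacity v w x)
  (same_regime : (C2%:E < saturating_capacity f w t0)%E \/
     (saturating_capacity f w t0 <= C1%:E)%E)
  (Q1_opt : optimal_range f v w C1 Q1)
  (Q2_opt : optimal_range f v w C2 Q2)
  (C1_lt_C2 : C1 < C2) :
  Q1 `<=` Q2.
Proof.
have [f_cont _ _] := f_C1.
have [A1 [p1 [q1 [opt1 cont1 E1]]]] := Q1_opt.
have [A2 [p2 [q2 [opt2 cont2 E2]]]] := Q2_opt.
rewrite E1 E2 => z /=; rewrite !in_itv/=.
have [scarce|sat1] := same_regime; last first.
  have sat2 : (saturating_capacity f w t0 <= C2%:E)%E.
    by apply: le_trans sat1 _; rewrite lee_fin ltW.
  have sat := saturated_range f_cont f_gt0 f_density v_C1 v_decr v0 v1 w_C1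
    w_ge0 w_decr w1 t0_in t0_zero t0_uniq.
  have [-> ->] := sat _ _ _ _ sat1 opt1 cont1.
  by have [-> ->] := sat _ _ _ _ sat2 opt2 cont2.
(* The worst quality is computed only for [C2], which is positive since [C2 > C1 >= 0]; [C1] itself
   may be 0, and its marginal quality is at most 1 in any case. *)
have [F1 _] := opt1; have [S1 uc1 _] := F1.
have C10 := capacity_used_ge0 f_gt0 w_ge0 F1.
have -> := scarce_worst_quality f_cont f_gt0 f_density v_C1 v_decr v0 v1 w_C1
  w_ge0 w_decr w1 t0_in t0_zero t0_uniq h_decr scarce (le_lt_trans C10 C1_lt_C2) opt2 cont2.
have q21 := best_quality_mono f_cont f_gt0 f_density v_C1 v_decr v0 v1 w_C1
  w_ge0 w_decr w1 h_decr C1_lt_C2 opt1 cont1 opt2.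
have := user_choice_quality S1 uc1 (marginal_user_01 q1).
lra.
Qed.
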